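(* Let $\bar D:\bar{\mathcal G}\to\bar{\mathcal G}$ be a partial Dehn twist relative to a set $\mathcal V_0=\{V_1,\dots,V_m\}$ of vertices of $\bar{\mathcal G}$, and assume that for each $V_i\in\mathcal V_0$ the vertex group automorphism $\bar D_{V_i}$ is induced by a Dehn twist $D_i:\mathcal G_i\to\mathcal G_i$; that is, there are a vertex $p_i\in V(\mathcal G_i)$ and a group isomorphism $\theta_i:G_{V_i}\to\pi_1(\mathcal G_i,p_i)$ with $\theta_i\circ\bar D_{V_i}=(D_i)_{*p_i}\circ\theta_i$. (1) $\bar D$ can be blown up via the given family of local Dehn twists $(D_i,\mathcal G_i)$ to give a graph-of-groups isomorphism $D:\mathcal G\to\mathcal G$ if and only if every edge $E$ of $\bar{\mathcal G}$ with $\tau(E)\in\mathcal V_0$ is locally zero. (2) The blow-up automorphism $D:\mathcal G\to\mathcal G$ obtained in (1) is a Dehn twist, and hence $\hat D=\hat{\bar D}$ (identified via the canonical isomorphism $\Theta:\pi_1(\bar{\mathcal G})\to\pi_1(\mathcal G)$) is a Dehn twist automorphism.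
   Context: Graphs are finite, non-empty, connected graphs in the sense of Serre: each edge $e$ is oriented with reverse $\bar e$ and terminal vertex $\tau(e)$, and $\iota(e)=\tau(\bar e)$. For $x$ in a group, $ad_x(g)=xgx^{-1}$. A graph-of-groups $\mathcal G$ consists of a graph $\Gamma=\Gamma(\mathcal G)$ (with vertex set $V(\mathcal G)$ and edge set $E(\mathcal G)$), vertex groups $G_v$, edge groups $G_e=G_{\bar e}$, and injective edge homomorphisms $f_e:G_e\to G_{\tau(e)}$. The path group $\Pi(\mathcal G)$ is the quotient of the free product of all $G_v$ and the free group on $\{t_e : e\in E(\Gamma)\}$ by the relations $t_{\bar e}=t_e^{-1}$ and $f_{\bar e}(g)=t_ef_e(g)t_e^{-1}$ ($g\in G_e$). A word $r_0t_{e_1}r_1\cdots t_{e_q}r_q$ ($q\ge 0$) is connected from $v$ to $w$ if $e_1\cdots e_q$ is an edge path from $v$ to $w$ and $r_0\in G_v$, $r_i\in G_{\tau(e_i)}$ (for $q=0$: $v=w$, $r_0\in G_v$). $\pi_1(\mathcal G,v)\subset\Pi(\mathcal G)$ is the subgroup of elements represented by connected words from $v$ to $v$. A sub-graph-of-groups is the restriction of $\mathcal G$ to a connected subgraph. A graph-of-groups isomorphism $H:\mathcal G_1\to\mathcal G_2$ consists of a graph isomorphism $H_\Gamma$, group isomorphisms $H_v:G_v\to G_{H_\Gamma(v)}$ and $H_e=H_{\bar e}:G_e\to G_{H_\Gamma(e)}$, and correction terms $\delta(e)\in G_{\tau(H_\Gamma(e))}$ with $H_{\tau(e)}f_e=ad_{\delta(e)}f_{H_\Gamma(e)}H_e$.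 It induces an isomorphism $H_*:\Pi(\mathcal G_1)\to\Pi(\mathcal G_2)$ by $H_*(g)=H_v(g)$ for $g\in G_v$ and $H_*(t_e)=\delta(\bar e)t_{H_\Gamma(e)}\delta(e)^{-1}$, which restricts to isomorphisms $H_{*v}:\pi_1(\mathcal G_1,v)\to\pi_1(\mathcal G_2,H_\Gamma(v))$; the resulting outer isomorphism $\hat H$ does not depend on the base point. (General) Dehn twist: a graph-of-groups automorphism $D:\mathcal G\to\mathcal G$ with $D_\Gamma=id$, all $D_v=id_{G_v}$, all $D_e=id_{G_e}$, and $\delta(e)\in C(f_e(G_e))$ (the centralizer of $f_e(G_e)$ in $G_{\tau(e)}$) for every edge $e$. It is a classical Dehn twist if moreover for each $e$ there is $\gamma_e\in Z(G_e)$ (the center) with $\delta(e)=f_e(\gamma_e)$. An automorphism $\phi$ of a group $G$ is a Dehn twist automorphism if $\phi=\theta^{-1}\circ D_{*v}\circ\theta$ for some classical Dehn twist $D:\mathcal G\to\mathcal G$ and some isomorphism $\theta:G\to\pi_1(\mathcal G,v)$; an outer automorphism is called a Dehn twist automorphism if it is the class of such a $\phi$. Partial Dehn twist relative to $\mathcal V_0$: $\mathcal V_0\subset V(\bar{\mathcal G})$ is such that every edge $e$ with $\tau(e)\in\mathcal V_0$ has trivial edge group, and $\bar D:\bar{\mathcal G}\to\bar{\mathcal G}$ is a graph-of-groups isomorphism acting as the identity on the underlying graph, with $\bar D_e=id$ for all edges, $\bar D_v=id$ for all vertices $v\notin\mathcal V_0$ ($\bar D_v$ is an arbitrary group automorphism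 if $v\in\mathcal V_0$), and $\delta(e)\in C(f_e(G_e))$ for all edges. Locally zero: an edge $E$ with $\tau(E)=V_i$ is locally zero if there are a vertex $v$ of $\mathcal G_i$ and an element $\gamma_E\in\Pi(\mathcal G_i)$ represented by a connected word from $p_i$ to $v$ with $(D_i)_*(\gamma_E^{-1})\,\theta_i(\delta(E))\,\gamma_E\in G_v$. Blow-up. A blow-up of $(\bar D,\bar{\mathcal G})$ via $(D_i,\mathcal G_i)_i$ is a graph-of-groups $\mathcal G$ with an isomorphism $D:\mathcal G\to\mathcal G$ acting as the identity on $\Gamma(\mathcal G)$, such that the $\mathcal G_i$ are pairwise disjoint sub-graphs-of-groups of $\mathcal G$, $D$ restricts to $D_i$ on each $\mathcal G_i$, and the quotient of $(D,\mathcal G)$ modulo the $(D_i,\mathcal G_i)$ is $(\bar D,\bar{\mathcal G})$. The latter means the following. The graph $\Gamma(\bar{\mathcal G})$ is obtained from $\Gamma(\mathcal G)$ by contracting each $\Gamma(\mathcal G_i)$ to the vertex $V_i$; the remaining vertices $v$ and edges $e$ of $\mathcal G$ are in natural bijection with the vertices $V\notin\mathcal V_0$ and the edges $E$ of $\bar{\mathcal G}$. For corresponding objects, $G_V=G_v$, $G_E=G_e$, $\bar D_V=D_v$, $\bar D_E=D_e$. If $\tau(E)\notin\mathcal V_0$, then $f_E=f_e$ and $\delta(E)=\delta(e)$. If $\tau(E)=V_i$, then $\tau(e)\in V(\mathcal G_i)$ and there is an element $\gamma_E\in\Pi(\mathcal G_i)$ represented by a connected word from $p_i$ to $\tau(e)$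 with $\theta_i\circ f_E=ad_{\gamma_E}\circ f_e$ and $\theta_i(\delta(E))=D_*(\gamma_E)\,\delta(e)\,\gamma_E^{-1}$. The canonical isomorphism $\Theta$ is the restriction to $\pi_1(\bar{\mathcal G},V_i)\to\pi_1(\mathcal G,p_i)$ of the homomorphism $\Pi(\bar{\mathcal G})\to\Pi(\mathcal G)$ which is $\theta_i$ on $G_{V_i}$, the identity on the other vertex groups, and sends $t_E\mapsto\gamma_{\bar E}t_e\gamma_E^{-1}$, where $\gamma_E:=1$ if $\tau(E)\notin\mathcal V_0$ (likewise for $\gamma_{\bar E}$). ''$\hat D=\hat{\bar D}$'' means $\hat\Theta\,\hat{\bar D}=\hat D\,\hat\Theta$. *)

(* Defs.v *)
From HB Require Import structures.
From mathcomp Require Import all_boot boolp.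

Set Implicit Arguments.
Unset Strict Implicit.
Unset Printing Implicit Defensive.

Local Open Scope quotient_scope.
Local Open Scope group_scope.

(* Groups are MathComp's [groupType]s, which may be infinite; the choice
   structure they carry is no restriction, classical logic being available.
   Subsets of groups are propositions turned into booleans by [`[< _ >]]. *)

Notation "{ 'gmorph' G -> H }" := (UMagmaMorphism.type G%type H%type)
  (at level 0, G at level 98, H at level 99, format "{ 'gmorph'  G  ->  H }")
  : type_scope.

Section MkGmorph.
Variables (G H : groupType) (f : G -> H) (fM : {morph f : x y / x * y}).

Lemma mk_gmorph1 : f 1 = 1.
Proof. by apply: (mulgI (f 1)); rewrite -fM !mulg1. Qed.

Definition mk_gmorph : {gmorph G -> H} :=
  HB.pack_for {gmorph G -> H} f
    (isMultiplicative.Build G H f fM)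
    (Multiplicative_isUMagmaMorphism.Build G H f mk_gmorph1).
End MkGmorph.

Definition ad (G : groupType) (x g : G) : G := x * g * x^-1.

(* [f] and [h] have the same class modulo inner automorphisms of [H]. *)
Definition outer_eq (G H : groupType) (f h : G -> H) : Prop :=
  exists y : H, forall x, f x = ad y (h x).

(* A Serre graph, presented by its set [geo] of geometric edges together with
   an orientation of each of them: the edges are the pairs (o, b), and reversal,
   which flips b, is an involution without fixed points.  The orientation is
   only a device that makes e and its reverse share their first component;
   every graph in the sense of Serre has such a presentation. *)
Record pregraph := PreGraph {
  vert : finType;
  geo : finType;
  tau : geo * bool -> vert }.

Notation edge X := (geo X * bool)%type.

Definition erev (X : pregraph) (e : edge X) : edge X := (e.1, ~~ e.2).

Definition iota (X : pregraph) (e : edge X) : vert X := tau (erev e).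

Fixpoint edge_path (X : pregraph) (v : vert X) (p : seq (edge X)) (w : vert X)
    : bool :=
  if p is e :: p' then (iota e == v) && edge_path (tau e) p' w else v == w.

Record graph := Graph {
  pregraph_of :> pregraph;
  graph_nonempty : exists v : vert pregraph_of, True;
  graph_connected : forall v w : vert pregraph_of, exists p, edge_path v p w }.

Lemma erevK (X : pregraph) : involutive (@erev X).
Proof. by case=> o b; rewrite /erev /= negbK. Qed.

(* An edge group is attached to a geometric edge, so that the edge groups of
   e and [erev e] coincide. *)
Record gog := Gog {
  gog_graph :> graph;
  vgrp : vert gog_graph -> groupType;
  egrp : geo gog_graph -> groupType;
  emap : forall e : edge gog_graph, {gmorph egrp e.1 -> vgrp (tau e)};
  emap_inj : forall e, injective (emap e) }.

Arguments vgrp {g} v : rename.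
Arguments egrp {g} o : rename.
Arguments emap {g} e : rename.

(* Equality of elements of vertex groups whose vertices are equal, but not
   convertible, is expressed in the disjoint union of the vertex groups. *)
Definition velt (X : gog) := {v : vert X & vgrp v}.
Definition ve (X : gog) (v : vert X) (g : vgrp v) : velt X := existT _ v g.

Section PathGroup.
Variable X : gog.

Definition word := seq (velt X + edge X)%type.

(* All the generators are invertible by the relations, so the path group is
   also the monoid with the same presentation. *)
Inductive path_rel : word -> word -> Prop :=
| path_one (v : vert X) : path_rel [:: inl (ve (1 : vgrp v))] [::]
| path_mul (v : vert X) (g h : vgrp v) :
    path_rel [:: inl (ve g); inl (ve h)] [:: inl (ve (g * h))]
| path_inv (e : edge X) : path_rel [:: inr e; inr (erev e)] [::]
| path_edge (e : edge X) (g : egrp e.1) :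
    path_rel [:: inl (ve (emap (erev e) g))]
             [:: inr e; inl (ve (emap e g)); inr (erev e)].

Inductive path_eq : word -> word -> Prop :=
| path_eq_rel a b : path_rel a b -> path_eq a b
| path_eq_refl a : path_eq a a
| path_eq_sym a b : path_eq a b -> path_eq b a
| path_eq_trans b a c : path_eq a b -> path_eq b c -> path_eq a c
| path_eq_cat a b c d : path_eq a b -> path_eq c d -> path_eq (a ++ c) (b ++ d).

Definition path_eqb (a b : word) : bool := `[< path_eq a b >].

Lemma path_eqb_refl : reflexive path_eqb.
Proof. by move=> a; apply/asboolP/path_eq_refl. Qed.
Lemma path_eqb_sym : symmetric path_eqb.
Proof. by move=> a b; apply/asboolP/asboolP; apply: path_eq_sym. Qed.
Lemma path_eqb_trans : transitive path_eqb.
Proof.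
by move=> b a c /asboolP ab /asboolP bc; apply/asboolP/(path_eq_trans ab).
Qed.

Canonical path_equiv := EquivRel path_eqb path_eqb_refl path_eqb_sym path_eqb_trans.

Definition path_quot := {eq_quot path_equiv}.
HB.instance Definition _ := Choice.on path_quot.

Definition pcls (a : word) : path_quot := \pi_path_quot a.

Lemma pclsP a b : pcls a = pcls b <-> path_eq a b.
Proof.
split=> [/eqP|ab]; first by rewrite piE => /asboolP.
by apply/eqP; rewrite piE; apply/asboolP.
Qed.

Lemma pcls_repr x : pcls (repr x) = x.
Proof. exact: reprK. Qed.

Definition letter_inv (l : velt X + edge X) : velt X + edge X :=
  match l with
  | inl u => inl (ve (tagged u)^-1)
  | inr e => inr (erev e)
  end.
Definition word_inv (a : word) : word := seq.rev (map letter_inv a).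

Definition path_mulg (x y : path_quot) := pcls (repr x ++ repr y).
Definition path_invg (x : path_quot) := pcls (word_inv (repr x)).

Lemma pcls_cat a b : pcls (a ++ b) = path_mulg (pcls a) (pcls b).
Proof.
by apply/pclsP/path_eq_cat; apply/pclsP; rewrite pcls_repr.
Qed.

Lemma path_mulgA : associative path_mulg.
Proof.
move=> x y z; rewrite -(pcls_repr x) -(pcls_repr y) -(pcls_repr z).
by rewrite -!pcls_cat catA.
Qed.
Lemma path_mul1g : left_id (pcls [::]) path_mulg.
Proof. by move=> x; rewrite -(pcls_repr x) -pcls_cat. Qed.
Lemma path_mulg1 : right_id (pcls [::]) path_mulg.
Proof. by move=> x; rewrite -(pcls_repr x) -pcls_cat cats0. Qed.

Lemma letter_invP l : path_eq [:: l; letter_inv l] [::].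
Proof.
case: l => [[v g]|e] /=; last exact/path_eq_rel/path_inv.
apply: path_eq_trans (path_eq_rel (path_one v)).
by apply: path_eq_trans (path_eq_rel (path_mul _ _)) _; rewrite mulgV; apply: path_eq_refl.
Qed.

Lemma letter_invK : involutive letter_inv.
Proof. by case=> [[v g]|e] /=; rewrite ?invgK ?erevK. Qed.

Lemma word_invK : involutive word_inv.
Proof.
move=> a; rewrite /word_inv map_rev revK -map_comp -[RHS]map_id.
by apply: eq_map => l /=; rewrite letter_invK.
Qed.

Lemma word_invP a : path_eq (a ++ word_inv a) [::].
Proof.
elim: a => [|l a IH]; first exact: path_eq_refl.
have -> : (l :: a) ++ word_inv (l :: a)
    = [:: l] ++ ((a ++ word_inv a) ++ [:: letter_inv l]).
  by rewrite /word_inv /= rev_cons -cats1 catA.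
apply: path_eq_trans (letter_invP l).
apply: (path_eq_cat (a := [:: l]) (b := [:: l])); first exact: path_eq_refl.
rewrite -[X in path_eq _ X]cat0s.
by apply: path_eq_cat; [exact: IH | exact: path_eq_refl].
Qed.

Lemma path_mulgV : right_inverse (pcls [::]) path_invg path_mulg.
Proof.
move=> x; rewrite -{1}(pcls_repr x) -pcls_cat.
exact/pclsP/word_invP.
Qed.
Lemma path_mulVg : left_inverse (pcls [::]) path_invg path_mulg.
Proof.
move=> x; rewrite -{2}(pcls_repr x) -pcls_cat -{2}[repr x]word_invK.
exact/pclsP/word_invP.
Qed.

HB.instance Definition _ := isGroup.Build path_quot
  path_mulgA path_mul1g path_mulg1 path_mulVg path_mulgV.

Definition path_group : groupType := path_quot.

Lemma pclsM a b : pcls (a ++ b) = (pcls a : path_group) * pcls b.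
Proof. exact: pcls_cat. Qed.
Lemma pcls1 : pcls [::] = 1 :> path_group.
Proof. by []. Qed.

Definition vin_fun (v : vert X) (g : vgrp v) : path_group := pcls [:: inl (ve g)].
Lemma vin_funM v : {morph @vin_fun v : g h / g * h}.
Proof.
by move=> g h; rewrite /vin_fun -pclsM; apply/pclsP/path_eq_sym/path_eq_rel/path_mul.
Qed.

Definition vin (v : vert X) : {gmorph vgrp v -> path_group} :=
  mk_gmorph (@vin_funM v).
Definition tin (e : edge X) : path_group := pcls [:: inr e].

Lemma vinE v g : vin v g = pcls [:: inl (ve g)].
Proof. by []. Qed.

Lemma tin_rev e : tin (erev e) = (tin e)^-1.
Proof.
apply/(mulgI (tin e)); rewrite mulgV -(pclsM [:: inr e]) -pcls1.
exact/pclsP/path_eq_rel/path_inv.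
Qed.

Lemma vin_edge e (g : egrp e.1) :
  vin _ (emap (erev e) g) = ad (tin e) (vin _ (emap e g)).
Proof.
rewrite /ad -tin_rev !vinE -(pclsM [:: inr e]) -pclsM.
exact/pclsP/path_eq_rel/path_edge.
Qed.

Lemma vin_ve v w (g : vgrp v) (h : vgrp w) : ve g = ve h -> vin _ g = vin _ h.
Proof. by rewrite !vinE => ->. Qed.

(* [conn v w x]: x is represented by a connected word from v to w. *)
Inductive conn : vert X -> vert X -> path_group -> Prop :=
| conn0 (v : vert X) (r : vgrp v) : conn v v (vin v r)
| connS (e : edge X) (w : vert X) (r : vgrp (iota e)) (x : path_group) :
    conn (tau e) w x -> conn (iota e) w (vin (iota e) r * tin e * x).

Lemma conn1 v : conn v v 1.
Proof. by rewrite -(gmulf1 (s := vin v)); apply: conn0. Qed.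

Lemma connM u v w x y : conn u v x -> conn v w y -> conn u w (x * y).
Proof.
move=> H; elim: H y w => {u v x} [v r|e v r x _ IH] y w H; last first.
  by rewrite -mulgA; apply: connS; apply: IH.
case: H r => {v w y} [v s|e w s y H] r; rewrite ?mulgA -gmulfM.
  exact: conn0.
exact: connS.
Qed.

Lemma conn_tin e : conn (iota e) (tau e) (tin e).
Proof.
by have := connS 1 (conn1 (tau e)); rewrite gmulf1 mul1g mulg1.
Qed.

Lemma connV v w x : conn v w x -> conn w v x^-1.
Proof.
elim=> {v w x} [v r|e w r x _ IH]; first by rewrite -gmulfV; apply: conn0.
rewrite !invgM; apply: connM (IH) _; rewrite -gmulfV -tin_rev.
apply: connM; last exact: conn0.
by have := conn_tin (erev e); rewrite /iota erevK.
Qed.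

Definition in_pi1 (v : vert X) : {pred path_group} := fun x => `[< conn v v x >].

Lemma in_pi1P v x : reflect (conn v v x) (x \in in_pi1 v).
Proof. exact: asboolP. Qed.

Lemma in_pi1_closed v : group_closed (in_pi1 v).
Proof.
split=> [|x y]; first exact/in_pi1P/conn1.
by move=> /in_pi1P Hx /in_pi1P Hy; apply/in_pi1P/connM/connV/Hy.
Qed.

Definition pi1_sub (v : vert X) := {x : path_group | in_pi1 v x}.
HB.instance Definition _ v := [isSub of pi1_sub v for @sval _ _].
HB.instance Definition _ v := [Choice of pi1_sub v by <:].
HB.instance Definition _ v :=
  SubChoice_isSubGroup.Build path_group (in_pi1 v) (pi1_sub v) (in_pi1_closed v).

Definition pi1 (v : vert X) : groupType := pi1_sub v.

Definition pi1_in (v : vert X) : {gmorph pi1 v -> path_group} :=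
  (val : pi1_sub v -> path_group).

Lemma pi1_in_inj v : injective (pi1_in v).
Proof. exact: val_inj. Qed.

Lemma pi1_in_conn v (x : pi1 v) : conn v v (pi1_in v x).
Proof. exact/in_pi1P/(valP (x : pi1_sub v)). Qed.

Section Lift.
Variables (K : groupType) (fv : forall v : vert X, {gmorph vgrp v -> K}).
Variable ft : edge X -> K.
Hypothesis ftV : forall e, ft (erev e) = (ft e)^-1.
Hypothesis ftE : forall e (g : egrp e.1),
  fv _ (emap (erev e) g) = ad (ft e) (fv _ (emap e g)).

Definition lift_letter (l : velt X + edge X) : K :=
  match l with inl u => fv _ (tagged u) | inr e => ft e end.
Definition lift_word (a : word) : K := \prod_(l <- a) lift_letter l.

Lemma lift_word_eq a b : path_eq a b -> lift_word a = lift_word b.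
Proof.
elim=> {a b} [a b|||b a c _ -> _ ->|a b c d _ IH1 _ IH2] //; last first.
  by rewrite /lift_word !big_cat /=; congr (_ * _).
rewrite /lift_word.
case=> [v|v g h|e|e g]; rewrite !big_cons !big_nil /= ?mulg1.
- exact: gmulf1.
- by rewrite gmulfM.
- by rewrite ftV mulgV.
- by rewrite ftE ftV /ad mulgA.
Qed.

Definition path_lift_fun (x : path_group) : K := lift_word (repr x).

Lemma path_lift_pcls a : path_lift_fun (pcls a) = lift_word a.
Proof. by apply: lift_word_eq; apply/pclsP; rewrite pcls_repr. Qed.

Lemma path_lift_funM : {morph path_lift_fun : x y / x * y}.
Proof.
move=> x y; rewrite -(pcls_repr x) -(pcls_repr y) -pclsM !path_lift_pcls.
by rewrite /lift_word big_cat.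
Qed.

Definition path_lift : {gmorph path_group -> K} := mk_gmorph path_lift_funM.

Lemma path_lift_vin v g : path_lift (vin v g) = fv v g.
Proof. by rewrite /= path_lift_pcls /lift_word big_seq1. Qed.
Lemma path_lift_tin e : path_lift (tin e) = ft e.
Proof. by rewrite /= path_lift_pcls /lift_word big_seq1. Qed.

End Lift.

End PathGroup.

Arguments vin {X} v.
Arguments tin {X} e.
Arguments conn {X} v w x.

Section Pi1Map.
Variables (X Y : gog) (f : {gmorph path_group X -> path_group Y}).
Variables (v : vert X) (w : vert Y).
Hypothesis f_conn : forall x, conn v v x -> conn w w (f x).

Lemma pi1_res_subproof (x : pi1 v) : in_pi1 w (f (pi1_in v x)).
Proof. exact/in_pi1P/f_conn/pi1_in_conn. Qed.

Definition pi1_res_fun (x : pi1 v) : pi1 w :=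
  exist _ (f (pi1_in v x)) (pi1_res_subproof x).

Lemma pi1_res_funM : {morph pi1_res_fun : x y / x * y}.
Proof. by move=> x y; apply: pi1_in_inj; rewrite gmulfM; apply: gmulfM. Qed.

Definition pi1_res : {gmorph pi1 v -> pi1 w} := mk_gmorph pi1_res_funM.

Lemma pi1_in_res x : pi1_in w (pi1_res x) = f (pi1_in v x).
Proof. by []. Qed.
End Pi1Map.

(* Automorphisms that act as the identity on the graph; all the automorphisms
   considered below are of this kind. *)
Record gog_aut (X : gog) := GogAut {
  avert : forall v : vert X, {gmorph vgrp v -> vgrp v};
  avert_bij : forall v, bijective (avert v);
  aedge : forall o : geo X, {gmorph egrp o -> egrp o};
  aedge_bij : forall o, bijective (aedge o);
  delta : forall e : edge X, vgrp (tau e);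
  aut_emap : forall (e : edge X) (g : egrp e.1),
    avert (tau e) (emap e g) = ad (delta e) (emap e (aedge e.1 g)) }.

Section PathMap.
Variables (X : gog) (D : gog_aut X).

Definition path_map_vert (v : vert X) : {gmorph vgrp v -> path_group X} :=
  (vin v \o avert D v : {gmorph _ -> _}).
Definition path_map_edge (e : edge X) : path_group X :=
  vin _ (delta D (erev e)) * tin e * (vin _ (delta D e))^-1.

Lemma path_map_vertE v g : path_map_vert v g = vin v (avert D v g).
Proof. by []. Qed.

Lemma path_map_edgeV e : path_map_edge (erev e) = (path_map_edge e)^-1.
Proof.
rewrite /path_map_edge.
have -> : vin _ (delta D (erev (erev e))) = vin _ (delta D e) by rewrite erevK.
by rewrite tin_rev !invgM invgK mulgA.
Qed.

Lemma path_map_edgeE e (g : egrp e.1) :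
  path_map_vert _ (emap (erev e) g)
    = ad (path_map_edge e) (path_map_vert _ (emap e g)).
Proof.
rewrite !path_map_vertE (aut_emap D (e := erev e)) (aut_emap D (e := e)).
rewrite /ad !gmulfM !gmulfV.
have -> := vin_edge (e := e) (aedge D e.1 g); rewrite /ad /path_map_edge.
by rewrite !invgM invgK !mulgA !mulgVK.
Qed.

Definition path_map : {gmorph path_group X -> path_group X} :=
  path_lift path_map_edgeV path_map_edgeE.

Lemma path_map_vin v g : path_map (vin v g) = path_map_vert v g.
Proof. exact: path_lift_vin. Qed.
Lemma path_map_tin e : path_map (tin e) = path_map_edge e.
Proof. exact: path_lift_tin. Qed.

Lemma path_map_conn v w x : conn v w x -> conn v w (path_map x).
Proof.
elim=> {v w x} [v r|e w r x _ IH].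
  by rewrite path_map_vin; apply: conn0.
rewrite !gmulfM path_map_vin path_map_tin; apply: connM (IH).
apply: connM (conn0 _) _; apply: connM (connM (conn0 _) (conn_tin e)) _.
exact/connV/conn0.
Qed.

Definition pi1_map (v : vert X) : {gmorph pi1 v -> pi1 v} :=
  pi1_res (@path_map_conn v v).

End PathMap.

Definition centralizes_edges (X : gog) (D : gog_aut X) : Prop :=
  forall (e : edge X) (g : egrp e.1), commute (delta D e) (emap e g).

Definition dehn_twist (X : gog) (D : gog_aut X) : Prop :=
  [/\ forall v g, avert D v g = g,
      forall o g, aedge D o g = g
    & centralizes_edges D].

Definition classical_dehn_twist (X : gog) (D : gog_aut X) : Prop :=
  dehn_twist D /\
  forall e : edge X, exists2 c : egrp e.1,
    (forall g, commute c g) & delta D e = emap e c.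

Definition dehn_twist_automorphism (G : groupType) (phi : G -> G) : Prop :=
  exists (X : gog) (D : gog_aut X) (v : vert X) (theta : {gmorph G -> pi1 v}),
    [/\ classical_dehn_twist D, bijective theta
      & forall x, theta (phi x) = pi1_map D v (theta x)].

Definition outer_dehn_twist_automorphism (G : groupType) (phi : G -> G) : Prop :=
  exists2 psi : G -> G, dehn_twist_automorphism psi & outer_eq psi phi.

Definition partial_dehn_twist (X : gog) (V0 : {set vert X}) (D : gog_aut X)
    : Prop :=
  [/\ forall e : edge X, tau e \in V0 -> forall g : egrp e.1, g = 1,
      forall o g, aedge D o g = g,
      forall v, v \notin V0 -> forall g, avert D v g = g
    & centralizes_edges D].

Definition edge_map (X Y : pregraph) (f : geo X -> geo Y) (e : edge X) : edge Y :=
  (f e.1, e.2).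

(* [Y] is (identified by the data below with) a sub-graph-of-groups of [X]; its
   graph is connected since [Y] is a graph of groups.  The orientation of [Y] is
   taken to be induced by that of [X], whence [edge_map]. *)
Record sub_gog (Y X : gog) := SubGog {
  sub_vert : vert Y -> vert X;
  sub_vert_inj : injective sub_vert;
  sub_geo : geo Y -> geo X;
  sub_geo_inj : injective sub_geo;
  sub_tau : forall e : edge Y, tau (edge_map sub_geo e) = sub_vert (tau e);
  sub_vgrp : forall v : vert Y, {gmorph vgrp v -> vgrp (sub_vert v)};
  sub_vgrp_bij : forall v, bijective (sub_vgrp v);
  sub_egrp : forall o : geo Y, {gmorph egrp o -> egrp (sub_geo o)};
  sub_egrp_bij : forall o, bijective (sub_egrp o);
  sub_emap : forall (e : edge Y) (g : egrp e.1),
    ve (emap (edge_map sub_geo e) (sub_egrp e.1 g))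
      = ve (sub_vgrp (tau e) (emap e g)) }.

Definition restricts_to (Y X : gog) (S : sub_gog Y X) (D : gog_aut X)
    (DY : gog_aut Y) : Prop :=
  [/\ forall v (g : vgrp v), avert D _ (sub_vgrp S v g) = sub_vgrp S v (avert DY v g),
      forall o (g : egrp o), aedge D _ (sub_egrp S o g) = sub_egrp S o (aedge DY o g)
    & forall e : edge Y, ve (delta D (edge_map (sub_geo S) e))
                         = ve (sub_vgrp S _ (delta DY e))].

Section SubPath.
Variables (Y X : gog) (S : sub_gog Y X).

Definition sub_path_vert (v : vert Y) : {gmorph vgrp v -> path_group X} :=
  (vin _ \o sub_vgrp S v : {gmorph _ -> _}).
Definition sub_path_edge (e : edge Y) : path_group X :=
  tin (edge_map (sub_geo S) e).

Lemma sub_path_vertE v g : sub_path_vert v g = vin _ (sub_vgrp S v g).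
Proof. by []. Qed.

Lemma sub_path_edgeV e : sub_path_edge (erev e) = (sub_path_edge e)^-1.
Proof. exact: (tin_rev (edge_map _ e)). Qed.

Lemma sub_path_edgeE e (g : egrp e.1) :
  sub_path_vert _ (emap (erev e) g)
    = ad (sub_path_edge e) (sub_path_vert _ (emap e g)).
Proof.
rewrite !sub_path_vertE.
rewrite -(vin_ve (sub_emap S (e := erev e) g)) -(vin_ve (sub_emap S (e := e) g)).
exact: (vin_edge (e := edge_map (sub_geo S) e)).
Qed.

Definition sub_path : {gmorph path_group Y -> path_group X} :=
  path_lift sub_path_edgeV sub_path_edgeE.

Lemma sub_path_vin v g : sub_path (vin v g) = sub_path_vert v g.
Proof. exact: path_lift_vin. Qed.
Lemma sub_path_tin e : sub_path (tin e) = sub_path_edge e.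
Proof. exact: path_lift_tin. Qed.

Lemma sub_path_conn v w x :
  conn v w x -> conn (sub_vert S v) (sub_vert S w) (sub_path x).
Proof.
elim=> {v w x} [v r|e w r x _ IH].
  by rewrite sub_path_vin; apply: conn0.
rewrite !gmulfM sub_path_vin sub_path_tin; apply: connM (IH).
apply: connM (conn0 _) _.
have := conn_tin (edge_map (sub_geo S) e).
by rewrite /iota -(sub_tau S (erev e)) -(sub_tau S e).
Qed.

End SubPath.

Definition mem_dec (T : finType) (A : {set T}) (x : T) :
  {x \in A} + {x \notin A} :=
  match boolP (x \in A) with AltTrue h => left h | AltFalse h => right h end.

Section BlowUp.

(* The local data are indexed by the subtype of the elements of V0, so that an
   edge e with [h : tau e \in V0] has the index [exist _ (tau e) h], and
   [vgrp (sval (exist _ (tau e) h))] is convertible to [vgrp (tau e)]. *)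
Variables (Xb : gog) (Db : gog_aut Xb) (V0 : {set vert Xb}).
Let idx := {V : vert Xb | V \in V0}.
Variables (Xi : idx -> gog) (Di : forall i, gog_aut (Xi i)).
Variables (p : forall i, vert (Xi i)).
Variable theta : forall i : idx, {gmorph vgrp (sval i) -> pi1 (p i)}.

(* [vin v x] ranges over the subgroup G_v of the path group. *)
Definition locally_zero (e : edge Xb) (h : tau e \in V0) : Prop :=
  let i : idx := exist _ (tau e) h in
  exists (v : vert (Xi i)) (gamma : path_group (Xi i)),
    conn (p i) v gamma /\
    exists x : vgrp v,
      path_map (Di i) (gamma^-1) * pi1_in _ (theta i (delta Db e)) * gamma = vin v x.

(* A blow-up (D, X): the sub-graphs-of-groups [bu_sub i] are collapsed, and
   [bu_vert], [bu_geo], [bu_vgrp], [bu_egrp] give the correspondence between the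
   vertices outside V0, the edges and the groups of Xb, and those of X outside
   the collapsed part; the orientation of Xb is induced by that of X. *)
Record blow_up (X : gog) (D : gog_aut X) := BlowUp {
  bu_sub : forall i, sub_gog (Xi i) X;
  bu_disjoint : forall i j v w,
    sub_vert (bu_sub i) v = sub_vert (bu_sub j) w -> i = j;
  bu_restr : forall i, restricts_to (bu_sub i) D (Di i);

  bu_vert : {V : vert Xb | V \notin V0} -> vert X;
  bu_vert_inj : injective bu_vert;
  bu_vert_im : forall v : vert X,
    (exists V, bu_vert V = v) <-> ~ (exists i w, sub_vert (bu_sub i) w = v);
  bu_geo : geo Xb -> geo X;
  bu_geo_inj : injective bu_geo;
  bu_geo_im : forall o : geo X,
    (exists O, bu_geo O = o) <-> ~ (exists i o', sub_geo (bu_sub i) o' = o);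

  bu_vgrp : forall V, {gmorph vgrp (sval V) -> vgrp (bu_vert V)};
  bu_vgrp_bij : forall V, bijective (bu_vgrp V);
  bu_egrp : forall O, {gmorph egrp O -> egrp (bu_geo O)};
  bu_egrp_bij : forall O, bijective (bu_egrp O);
  bu_avert : forall V g, bu_vgrp V (avert Db _ g) = avert D _ (bu_vgrp V g);
  bu_aedge : forall O g, bu_egrp O (aedge Db _ g) = aedge D _ (bu_egrp O g);

  bu_tau_out : forall (e : edge Xb) (h : tau e \notin V0),
    tau (edge_map bu_geo e) = bu_vert (exist _ (tau e) h);
  bu_emap_out : forall (e : edge Xb) (h : tau e \notin V0) (g : egrp e.1),
    ve (emap (edge_map bu_geo e) (bu_egrp e.1 g))
      = ve (bu_vgrp (exist _ (tau e) h) (emap e g));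
  bu_delta_out : forall (e : edge Xb) (h : tau e \notin V0),
    ve (delta D (edge_map bu_geo e)) = ve (bu_vgrp (exist _ (tau e) h) (delta Db e));

  (* [bu_att h] is the terminal vertex of e in X.  The equations hold in the path
     group of the local graph of groups: x is the element of its vertex group
     that [bu_sub] identifies with the given element of the vertex group of X. *)
  bu_att : forall (e : edge Xb) (h : tau e \in V0), vert (Xi (exist _ (tau e) h));
  bu_tau_in : forall (e : edge Xb) (h : tau e \in V0),
    tau (edge_map bu_geo e) = sub_vert (bu_sub _) (bu_att h);
  bu_gamma : forall (e : edge Xb) (h : tau e \in V0),
    path_group (Xi (exist _ (tau e) h));
  bu_gamma_conn : forall (e : edge Xb) (h : tau e \in V0),
    conn (p _) (bu_att h) (bu_gamma h);
  bu_emap_in : forall (e : edge Xb) (h : tau e \in V0) (g : egrp e.1)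
      (x : vgrp (bu_att h)),
    ve (sub_vgrp (bu_sub _) _ x) = ve (emap (edge_map bu_geo e) (bu_egrp e.1 g)) ->
    pi1_in _ (theta (exist _ (tau e) h) (emap e g)) = ad (bu_gamma h) (vin _ x);
  bu_delta_in : forall (e : edge Xb) (h : tau e \in V0) (x : vgrp (bu_att h)),
    ve (sub_vgrp (bu_sub _) _ x) = ve (delta D (edge_map bu_geo e)) ->
    pi1_in _ (theta (exist _ (tau e) h) (delta Db e))
      = path_map (Di _) (bu_gamma h) * vin _ x * (bu_gamma h)^-1 }.

Variables (X : gog) (D : gog_aut X) (B : blow_up D).

(* The base point of X for V: the vertex p_i if V = V_i, the vertex of X
   corresponding to V if V is not in V0. *)
Definition bu_base (V : vert Xb) : vert X :=
  match mem_dec V0 V with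
  | left h => sub_vert (bu_sub B _) (p (exist _ V h))
  | right h => bu_vert B (exist _ V h)
  end.

Definition Theta_in (V : vert Xb) (h : V \in V0) : {gmorph vgrp V -> path_group X} :=
  let i : idx := exist _ V h in
  (sub_path (bu_sub B i) \o (pi1_in (p i) \o theta i) : {gmorph _ -> _}).
Definition Theta_out (V : vert Xb) (h : V \notin V0)
    : {gmorph vgrp V -> path_group X} :=
  let j : {V : vert Xb | V \notin V0} := exist _ V h in
  (vin _ \o bu_vgrp B j : {gmorph _ -> _}).

Lemma Theta_inE V h g :
  @Theta_in V h g = sub_path (bu_sub B _) (pi1_in _ (theta (exist _ V h) g)).
Proof. by []. Qed.
Lemma Theta_outE V h g : @Theta_out V h g = vin _ (bu_vgrp B (exist _ V h) g).
Proof. by []. Qed.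

Definition Theta_vert (V : vert Xb) : {gmorph vgrp V -> path_group X} :=
  match mem_dec V0 V with
  | left h => Theta_in h
  | right h => Theta_out h
  end.

Definition Theta_gamma (e : edge Xb) : path_group X :=
  match mem_dec V0 (tau e) with
  | left h => sub_path (bu_sub B _) (bu_gamma B h)
  | right _ => 1
  end.

Definition Theta_edge (e : edge Xb) : path_group X :=
  Theta_gamma (erev e) * tin (edge_map (bu_geo B) e) * (Theta_gamma e)^-1.

Lemma sub_vgrp_lift i (w : vert (Xi i)) (v : vert X) (y : vgrp v) :
  v = sub_vert (bu_sub B i) w ->
  exists x : vgrp w, ve (sub_vgrp (bu_sub B i) w x) = ve y.
Proof.
move=> E; move: y; rewrite E => y; have [f _ fK] := sub_vgrp_bij (bu_sub B i) w.
by exists (f y); rewrite fK.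
Qed.

Lemma Theta_emap e (g : egrp e.1) :
  Theta_vert _ (emap e g)
    = ad (Theta_gamma e) (vin _ (emap (edge_map (bu_geo B) e) (bu_egrp B e.1 g))).
Proof.
rewrite /Theta_vert /Theta_gamma; case: mem_dec => h.
  have [x xE] :=
    sub_vgrp_lift (emap (edge_map (bu_geo B) e) (bu_egrp B e.1 g)) (bu_tau_in B h).
  rewrite Theta_inE (bu_emap_in xE) /ad !gmulfM gmulfV sub_path_vin.
  by rewrite sub_path_vertE (vin_ve xE).
rewrite /ad mul1g invg1 mulg1 Theta_outE; apply: vin_ve.
by rewrite (bu_emap_out B h).
Qed.

Lemma Theta_edgeV e : Theta_edge (erev e) = (Theta_edge e)^-1.
Proof.
rewrite /Theta_edge erevK !invgM invgK mulgA -tin_rev.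
by congr (_ * _ * _).
Qed.

Lemma Theta_edgeE e (g : egrp e.1) :
  Theta_vert _ (emap (erev e) g) = ad (Theta_edge e) (Theta_vert _ (emap e g)).
Proof.
rewrite (Theta_emap (e := erev e)) (Theta_emap (e := e)).
have -> := vin_edge (e := edge_map (bu_geo B) e) (bu_egrp B e.1 g).
by rewrite /ad /Theta_edge !invgM invgK !mulgA !mulgVK.
Qed.

Definition Theta_path : {gmorph path_group Xb -> path_group X} :=
  path_lift Theta_edgeV Theta_edgeE.

Lemma Theta_path_vin V g : Theta_path (vin V g) = Theta_vert V g.
Proof. exact: path_lift_vin. Qed.
Lemma Theta_path_tin e : Theta_path (tin e) = Theta_edge e.
Proof. exact: path_lift_tin. Qed.

Lemma Theta_vert_conn V g : conn (bu_base V) (bu_base V) (Theta_vert V g).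
Proof.
rewrite /bu_base /Theta_vert; case: mem_dec => h; last exact: conn0.
by apply: sub_path_conn; apply/pi1_in_conn.
Qed.

Lemma Theta_gamma_conn e :
  conn (bu_base (tau e)) (tau (edge_map (bu_geo B) e)) (Theta_gamma e).
Proof.
rewrite /bu_base /Theta_gamma; case: mem_dec => h.
  by rewrite (bu_tau_in B h); apply/sub_path_conn/bu_gamma_conn.
by rewrite (bu_tau_out B h); apply: conn1.
Qed.

Lemma Theta_path_conn V W x :
  conn V W x -> conn (bu_base V) (bu_base W) (Theta_path x).
Proof.
elim=> {V W x} [V r|e W r x _ IH].
  by rewrite Theta_path_vin; apply: Theta_vert_conn.
rewrite !gmulfM Theta_path_vin Theta_path_tin; apply: connM (IH).
apply: connM (Theta_vert_conn _) _.
apply: connM; last exact/connV/Theta_gamma_conn.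
apply: connM (Theta_gamma_conn (erev e)) _.
exact: (conn_tin (edge_map (bu_geo B) e)).
Qed.

Definition Theta (V : vert Xb) : {gmorph pi1 V -> pi1 (bu_base V)} :=
  pi1_res (@Theta_path_conn V V).

End BlowUp.

(* Main.v *)
From mathcomp Require Import all_boot boolp.
From HB Require Import structures.
Require Import Defs.

(** Collapsing a sub-graph-of-groups forgets where, inside it, each adjacent
edge ends.  To blow up the vertex V_i is to choose, for every edge E ending at
V_i, a vertex of G_i and a connecting path gamma_E.  As G_E is trivial, any
choice is compatible with the edge homomorphisms.  The correction term of E is
the only constraint: delta(E) is carried by theta_i to a loop at p_i, and it
has to become, after conjugation by gamma_E twisted by D_i, an element of the
chosen vertex group.  This is local zeroness, so that a blow-up yields it
([blow_up_locally_zero]), and a choice of witnesses is all that is needed to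
build a blow-up ([blow_up_exists]).

Let (D, X) be a blow-up.  Each vertex and each edge of X comes from some G_i or
from the collapsed graph of groups, and the conditions of a Dehn twist are
inherited from there; at an edge ending at V_i the condition on centralizers is
empty because the edge group is trivial ([blow_up_dehn_twist]).  The maps
induced by D and by the collapsed automorphism are intertwined by Theta already
on path groups, hence with trivial conjugator ([Theta_path_map]): on a stable
letter this is the relation between delta(E) and delta(e) imposed by the
blow-up.

The homomorphism Theta is not onto on path groups, but it has a left inverse R
there, which retracts each path group of G_i onto the fundamental group at p_i
along a chosen system of paths.  On an element x represented by a connected
word from v to w, the composite Theta R multiplies x on both sides by paths
that depend on v and w only and are trivial at the base points; it is therefore
the identity on fundamental groups ([pi1_res_bij], [Theta_bij]).

It remains to see that a general Dehn twist D induces Dehn twist automorphisms,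
which are defined by classical ones ([dehn_twist_pi1_map]).  Subdivide each
geometric edge into three, and give the new vertex and the new edge next to
tau(e) the centralizer of delta(e) in the group of tau(e); it contains the image
of G_e.  The fundamental group is the same, and D becomes the twist by delta(e)
along the new edge next to tau(e), which is classical since delta(e) is central
in its own centralizer. *)

Set Implicit Arguments.
Unset Strict Implicit.
Unset Printing Implicit Defensive.

Local Open Scope group_scope.

(** * Groups, elements of vertex groups, and transport along bijections *)

Lemma gmorph_inv (G H : groupType) (f : {gmorph G -> H}) :
  bijective f -> exists f' : {gmorph H -> G}, cancel f f' /\ cancel f' f.
Proof. by case=> f' fK f'K; exists (mk_gmorph (can2_gmulfM fK f'K)). Qed.

Lemma idfun_bij T : bijective (@idfun T).
Proof. by exists id. Qed.

Section Inverse.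
Variables (G H : groupType) (f : {gmorph G -> H}) (f_bij : bijective f).

Definition gmorph_inverse : {gmorph H -> G} := sval (cid (gmorph_inv f_bij)).

Lemma gmorphK : cancel f gmorph_inverse.
Proof. by case: (svalP (cid (gmorph_inv f_bij))). Qed.

Lemma gmorphVK : cancel gmorph_inverse f.
Proof. by case: (svalP (cid (gmorph_inv f_bij))). Qed.
End Inverse.

Lemma adM (G : groupType) (x : G) : {morph ad x : g h / g * h}.
Proof. by move=> g h; rewrite /ad !mulgA mulgVK. Qed.

Lemma ve_inj (X : gog) (v : vert X) (g h : vgrp v) : ve g = ve h -> g = h.
Proof. exact: eq_from_Tagged. Qed.

Lemma mem_decT (T : finType) (A : {set T}) x (h : x \in A) :
  mem_dec A x = left h.
Proof.
case: mem_dec => h'; first by rewrite (bool_irrelevance h' h).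
by exfalso; move: h'; rewrite h.
Qed.

Lemma mem_decF (T : finType) (A : {set T}) x (h : x \notin A) :
  mem_dec A x = right h.
Proof.
case: mem_dec => h'; last by rewrite (bool_irrelevance h' h).
by exfalso; move: h; rewrite h'.
Qed.

(** Families indexed by the vertices or the edges of an abstract graph are
defined by their values on a concrete index set in bijection with it; the
equation holds without a cast because equality proofs in T are unique. *)
Lemma transport (S T : eqType) (f : S -> T) (P : T -> Type)
    (F : forall s, P (f s)) : injective f -> (forall t, exists s, f s = t) ->
  exists F' : forall t, P t, forall s, F' (f s) = F s.
Proof.
move=> f_inj /choice[g gK].
exists (fun t => eq_rect (f (g t)) P (F (g t)) t (gK t)) => s.
move: (gK (f s)); have -> : g (f s) = s by apply: f_inj.
by move=> E; rewrite (eq_irrelevance E (erefl _)).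
Qed.

(** * Connectedness of graphs *)

Definition reach (Y : pregraph) (v w : vert Y) : Prop :=
  exists q, edge_path v q w.

Lemma reach_refl (Y : pregraph) (v : vert Y) : reach v v.
Proof. by exists [::]; rewrite /= eqxx. Qed.

Lemma reach_trans (Y : pregraph) (u v w : vert Y) :
  reach u v -> reach v w -> reach u w.
Proof.
case=> q Hq [r Hr]; exists (q ++ r); elim: q u Hq => [|e q IH] u /=.
  by move/eqP->.
by case/andP=> -> /IH.
Qed.

Lemma reach_edge (Y : pregraph) (e : edge Y) : reach (iota e) (tau e).
Proof. by exists [:: e]; rewrite /= !eqxx. Qed.

Lemma reach_sym (Y : pregraph) (v w : vert Y) : reach v w -> reach w v.
Proof.
case=> q; elim: q v => [|e q IH] v /=; first by move/eqP->; apply: reach_refl.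
case/andP=> /eqP<- /IH we; apply: reach_trans we _.
by have := reach_edge (erev e); rewrite /iota erevK.
Qed.

Lemma reach_hom (Y Z : pregraph) (f : vert Y -> vert Z) :
  (forall e : edge Y, reach (f (iota e)) (f (tau e))) ->
  forall v w, reach v w -> reach (f v) (f w).
Proof.
move=> fe v w [q]; elim: q v => [|e q IH] v /=.
  by move/eqP->; apply: reach_refl.
by case/andP=> /eqP<- /IH; apply: reach_trans.
Qed.

(** * Homomorphisms of path groups and fundamental groups *)

Section PathGroup.
Variable X : gog.

Lemma path_hom_ext (K : groupType) (f h : {gmorph path_group X -> K}) :
  (forall v g, f (vin v g) = h (vin v g)) ->
  (forall e, f (tin e) = h (tin e)) -> f =1 h.
Proof.
move=> fv ft x; rewrite -(pcls_repr x); elim: (repr x) => [|l a IH].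
  by rewrite pcls1 !gmulf1.
rewrite -cat1s pclsM !gmulfM IH; congr (_ * _).
by case: l => [[v g]|e]; [apply: fv | apply: ft].
Qed.

(** In groupoid terms C is a natural transformation from h to f, and naturality
only has to be tested on generators. *)
Lemma conn_natural (K : groupType) (f h : {gmorph path_group X -> K})
    (C : vert X -> K) :
  (forall v g, f (vin v g) = ad (C v) (h (vin v g))) ->
  (forall e, f (tin e) = C (iota e) * h (tin e) * (C (tau e))^-1) ->
  forall v w x, conn v w x -> f x = C v * h x * (C w)^-1.
Proof.
move=> fv ft v w x; elim=> {v w x} [v r|e w r x _ IH]; first exact: fv.
by rewrite !gmulfM fv ft IH /ad !mulgA !mulgVK.
Qed.

Lemma conn_hom (Y : gog) (f : {gmorph path_group X -> path_group Y})
    (b : vert X -> vert Y) :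
  (forall v g, conn (b v) (b v) (f (vin v g))) ->
  (forall e, conn (b (iota e)) (b (tau e)) (f (tin e))) ->
  forall v w x, conn v w x -> conn (b v) (b w) (f x).
Proof.
move=> fv ft v w x; elim=> {v w x} [v r|e w r x _ IH]; first exact: fv.
by rewrite !gmulfM; apply: connM (connM (fv _ _) (ft _)) IH.
Qed.

Lemma path_conn_exists (v w : vert X) : exists x, conn v w x.
Proof.
have [q] := graph_connected v w; elim: q v => [|e q IH] v /=.
  by move/eqP->; exists 1; apply: conn1.
case/andP=> /eqP<- /IH[x Hx]; exists (tin e * x).
  exact: connM (conn_tin e) Hx.
Qed.

Lemma based_paths (p : vert X) :
  exists2 c : vert X -> path_group X, c p = 1 & forall v, conn p v (c v).
Proof.
have [c cP] := choice (path_conn_exists p).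
exists (fun v => if v == p then 1 else c v) => [|v]; first by rewrite eqxx.
by case: eqP => [->|_]; [apply: conn1 | apply: cP].
Qed.

(** Paths c from p to all vertices close up every connected word to a loop at p;
this is a homomorphism on the whole path group, and a retraction onto the
fundamental group at p if c p = 1. *)
Section Retraction.
Variables (p : vert X) (c : vert X -> path_group X).
Hypothesis c_conn : forall v, conn p v (c v).

Definition loop x (xP : conn p p x) : pi1 p :=
  exist _ x (introT (in_pi1P p x) xP).

Lemma loopE x (xP : conn p p x) : pi1_in p (loop xP) = x.
Proof. by []. Qed.

Lemma loop_vert_conn v (g : vgrp v) : conn p p (ad (c v) (vin v g)).
Proof. exact: connM (connM (c_conn v) (conn0 g)) (connV (c_conn v)). Qed.

Lemma loop_vertM v :
  {morph (fun g => loop (@loop_vert_conn v g)) : g h / g * h}.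
Proof.
by move=> g h; apply: pi1_in_inj; rewrite [RHS]gmulfM !loopE gmulfM adM.
Qed.

Definition loop_vert v : {gmorph vgrp v -> pi1 p} := mk_gmorph (@loop_vertM v).

Lemma loop_edge_conn e : conn p p (c (iota e) * tin e * (c (tau e))^-1).
Proof.
exact: connM (connM (c_conn _) (conn_tin e)) (connV (c_conn _)).
Qed.

Lemma loop_edgeV e :
  loop (loop_edge_conn (erev e)) = (loop (loop_edge_conn e))^-1.
Proof.
apply: pi1_in_inj; rewrite gmulfV !loopE tin_rev /iota erevK.
by rewrite !invgM invgK mulgA.
Qed.

Lemma loop_edgeE e (g : egrp e.1) :
  loop_vert _ (emap (erev e) g)
    = ad (loop (loop_edge_conn e)) (loop_vert _ (emap e g)).
Proof.
apply: pi1_in_inj; rewrite {1}/ad !gmulfM gmulfV !loopE vin_edge /ad.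
by rewrite !invgM invgK /iota !mulgA !mulgVK.
Qed.

Definition retraction : {gmorph path_group X -> pi1 p} :=
  path_lift loop_edgeV loop_edgeE.

Lemma retractionE v w x :
  conn v w x -> pi1_in p (retraction x) = c v * x * (c w)^-1.
Proof.
apply: (conn_natural (f := (pi1_in p \o retraction : {gmorph _ -> _}))
                     (h := (idfun : {gmorph _ -> _}))) => [{}v g|e].
  have := @path_lift_vin _ _ loop_vert _ loop_edgeV loop_edgeE v g.
  by move=> /(congr1 (pi1_in p)).
have := @path_lift_tin _ _ loop_vert _ loop_edgeV loop_edgeE e.
by move=> /(congr1 (pi1_in p)).
Qed.
End Retraction.

End PathGroup.

(** A homomorphism F of path groups need not be onto for its restrictions to
fundamental groups to be bijective: it is enough that it has a left inverse R
preserving connected words such that F R is natural, through paths C that are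
trivial at the vertices coming from X. *)
Lemma pi1_res_bij (X Y : gog) (F : {gmorph path_group X -> path_group Y})
    (b : vert X -> vert Y)
    (F_conn : forall v w x, conn v w x -> conn (b v) (b w) (F x))
    (R : {gmorph path_group Y -> path_group X}) (b' : vert Y -> vert X)
    (C : vert Y -> path_group Y) :
  (forall v w x, conn v w x -> conn (b' v) (b' w) (R x)) ->
  cancel F R -> cancel b b' -> (forall v, C (b v) = 1) ->
  (forall v w x, conn v w x -> F (R x) = C v * x * (C w)^-1) ->
  forall v, bijective (pi1_res (@F_conn v v)).
Proof.
move=> R_conn FK bK C1 RK v.
have R_conn' x : conn (b v) (b v) x -> conn v v (R x).
  by move/R_conn; rewrite bK.
exists (pi1_res R_conn') => x; apply: pi1_in_inj; rewrite !pi1_in_res.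
  exact: FK.
by rewrite (RK _ _ _ (pi1_in_conn x)) C1 mul1g invg1 mulg1.
Qed.

(** * General Dehn twists are classical on a subdivision *)

Section Centralizer.
Variables (G : groupType) (c : G).

Definition in_cent : {pred G} := fun g => `[< commute c g >].

Lemma in_centP g : reflect (commute c g) (g \in in_cent).
Proof. exact: asboolP. Qed.

Lemma in_cent_closed : group_closed in_cent.
Proof.
split=> [|g h /in_centP cg /in_centP ch]; apply/in_centP; first exact: commute1.
exact: commuteM cg (commuteV ch).
Qed.

Definition cent_sub := {g : G | in_cent g}.
HB.instance Definition _ := [isSub of cent_sub for @sval _ _].
HB.instance Definition _ := [Choice of cent_sub by <:].
HB.instance Definition _ :=
  SubChoice_isSubGroup.Build G in_cent cent_sub in_cent_closed.

Definition centralizer : groupType := cent_sub.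

Definition cent_in : {gmorph centralizer -> G} := (val : cent_sub -> G).

Lemma cent_in_inj : injective cent_in.
Proof. exact: val_inj. Qed.

Lemma cent_in_commute g : commute c (cent_in g).
Proof. exact/in_centP/(valP (g : cent_sub)). Qed.

Definition cent_elt g (cg : commute c g) : centralizer :=
  exist _ g (introT (in_centP g) cg).

Lemma cent_eltE g (cg : commute c g) : cent_in (cent_elt cg) = g.
Proof. by []. Qed.

Section Corestriction.
Variables (H : groupType) (f : {gmorph H -> G}).
Hypothesis cf : forall h, commute c (f h).

Lemma cent_resM : {morph (fun h => cent_elt (cf h)) : g h / g * h}.
Proof.
by move=> g h; apply: cent_in_inj; rewrite [RHS]gmulfM !cent_eltE gmulfM.
Qed.

Definition cent_res : {gmorph H -> centralizer} := mk_gmorph cent_resM.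

Lemma cent_resE h : cent_in (cent_res h) = f h.
Proof. by []. Qed.
End Corestriction.

End Centralizer.

(** The edge e of X becomes the path from iota e through the vertices
[inr (erev e)] and [inr e] to tau e.  Its middle part is [sd_mid e]; the part
[sd_out e] from [inr e] to tau e carries the centralizer of delta(e), and the
part from iota e is the reverse of [sd_out (erev e)].  All of the twist is
moved to the outer parts. *)
Section Subdivision.
Variables (X : gog) (D : gog_aut X).
Hypothesis D_cent : centralizes_edges D.

Definition sd_tau (e : (geo X + edge X) * bool) : vert X + edge X :=
  match e with
  | (inl o, b) => inr (o, b)
  | (inr e, true) => inl (tau e)
  | (inr e, false) => inr e
  end.

Definition sd_pregraph : pregraph :=
  @PreGraph (vert X + edge X)%type (geo X + edge X)%type sd_tau.

Lemma sd_reach_out (e : edge X) : @reach sd_pregraph (inr e) (inl (tau e)).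
Proof. exact: (@reach_edge sd_pregraph (inr e, true)). Qed.

Lemma sd_reach_in (v w : vert X) : @reach sd_pregraph (inl v) (inl w).
Proof.
apply: (reach_hom (f := inl : vert X -> vert sd_pregraph))
  (graph_connected v w).
move=> e; apply: reach_trans (reach_sym (sd_reach_out (erev e))) _.
apply: reach_trans (sd_reach_out e).
by case: e => o b; apply: (@reach_edge sd_pregraph (inl o, b)).
Qed.

Lemma sd_reach (v w : vert sd_pregraph) : reach v w.
Proof.
have to v' : exists u : vert X, @reach sd_pregraph v' (inl u).
  case: v' => [u|e]; first by exists u; apply: reach_refl.
  by exists (tau e); apply: sd_reach_out.
have [[u vu] [u' wu']] := (to v, to w).
exact: reach_trans (reach_trans vu (sd_reach_in u u')) (reach_sym wu').
Qed.

Lemma sd_nonempty : exists v : vert sd_pregraph, True.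
Proof. by have [v _] := graph_nonempty X; exists (inl v). Qed.

Definition sd_graph : graph := Graph sd_nonempty sd_reach.

Definition sd_vgrp (v : vert sd_graph) : groupType :=
  match v with inl v => vgrp v | inr e => centralizer (delta D e) end.

Definition sd_egrp (o : geo sd_graph) : groupType :=
  match o with inl o => egrp o | inr e => centralizer (delta D e) end.

Definition sd_emap (e : edge sd_graph)
    : {gmorph sd_egrp e.1 -> sd_vgrp (tau e)} :=
  match e with
  | (inl o, b) => cent_res (@D_cent (o, b))
  | (inr e, true) => cent_in (delta D e)
  | (inr e, false) => (idfun : {gmorph _ -> _})
  end.

Lemma sd_emap_inj e : injective (sd_emap e).
Proof.
case: e => [[o b|e []]] //=; last exact: cent_in_inj.
by move=> g h /(congr1 (@cent_in _ _)); rewrite !cent_resE => /emap_inj.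
Qed.

Definition sd_gog : gog := Gog sd_emap_inj.

Definition sd_delta (e : edge sd_gog) : vgrp (tau e) :=
  match e with
  | (inr e, true) => delta D e
  | (inl o, b) => (1 : centralizer (delta D (o, b)))
  | (inr e, false) => (1 : centralizer (delta D e))
  end.

Lemma sd_aut_emap (e : edge sd_gog) (g : egrp e.1) :
  emap e g = ad (sd_delta e) (emap e g).
Proof.
case: e g => [[o b|e []]] /= g; rewrite /ad ?mul1g ?invg1 ?mulg1 //.
by rewrite (cent_in_commute g) mulgK.
Qed.

Definition sd_aut : gog_aut sd_gog :=
  @GogAut sd_gog (fun v => idfun) (fun v => idfun_bij _)
    (fun o => idfun) (fun o => idfun_bij _) sd_delta sd_aut_emap.

Lemma sd_classical : classical_dehn_twist sd_aut.
Proof.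
split=> [|[[o b|e []]] /=].
- split=> // -[[o b|e []]] /= g; rewrite /commute ?mul1g ?mulg1 //.
  exact: cent_in_commute.
- exists 1 => [g|]; first by rewrite /commute mul1g mulg1.
  by have := gmulf1 (s := cent_res (@D_cent (o, b))) => /esym.
- (* delta(e) lies in its own centralizer, in which it is central *)
  exists (cent_elt (commute_refl (delta D e))) => // g.
  by apply: cent_in_inj; rewrite !gmulfM; apply: cent_in_commute.
- by exists 1 => // g; rewrite /commute mul1g mulg1.
Qed.


Definition sd_mid (e : edge X) : edge sd_gog := (inl e.1, e.2).
Definition sd_out (e : edge X) : edge sd_gog := (inr e, true).

(** Along [sd_out e] the group of the new vertex is a conjugate of a subgroup of
the group of tau e, so that adding the new vertex does not enlarge the
fundamental group. *)
Lemma sd_out_cent (e : edge X) (g : centralizer (delta D e)) :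
  vin (inr e : vert sd_gog) g
    = ad (tin (sd_out e)) (vin (inl (tau e) : vert sd_gog) (cent_in _ g)).
Proof. exact: (vin_edge (e := sd_out e) g). Qed.

Definition sd_path_vert (v : vert X) : {gmorph vgrp v -> path_group sd_gog} :=
  vin (inl v : vert sd_gog).
Definition sd_path_edge (e : edge X) : path_group sd_gog :=
  (tin (sd_out (erev e)))^-1 * tin (sd_mid e) * tin (sd_out e).

Lemma sd_path_edgeV e : sd_path_edge (erev e) = (sd_path_edge e)^-1.
Proof.
rewrite /sd_path_edge erevK !invgM invgK mulgA.
by congr (_ * _ * _); rewrite -tin_rev.
Qed.

Lemma sd_path_edgeE e (g : egrp e.1) :
  sd_path_vert _ (emap (erev e) g)
    = ad (sd_path_edge e) (sd_path_vert _ (emap e g)).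
Proof.
have cg e' (g' : egrp e'.1) : sd_path_vert _ (emap e' g')
    = ad (tin (sd_out e'))^-1
         (vin (inr e' : vert sd_gog) (cent_res (@D_cent e') g')).
  rewrite sd_out_cent cent_resE /ad invgK !mulgA mulVg mul1g mulgVK //.
rewrite !cg.
have -> : vin (inr (erev e) : vert sd_gog) (cent_res (@D_cent (erev e)) g)
   = ad (tin (sd_mid e)) (vin (inr e : vert sd_gog) (cent_res (@D_cent e) g)).
  by case: e g => o b g; apply: (vin_edge (X := sd_gog) (e := (inl o, b)) g).
by rewrite /ad /sd_path_edge !invgM !invgK !mulgA !mulgK.
Qed.

Definition sd_path : {gmorph path_group X -> path_group sd_gog} :=
  path_lift sd_path_edgeV sd_path_edgeE.

Lemma sd_path_vin v g : sd_path (vin v g) = vin (inl v : vert sd_gog) g.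
Proof. exact: path_lift_vin. Qed.
Lemma sd_path_tin e : sd_path (tin e) = sd_path_edge e.
Proof. exact: path_lift_tin. Qed.

Lemma sd_path_conn v w x :
  conn v w x -> conn (inl v : vert sd_gog) (inl w) (sd_path x).
Proof.
apply: (conn_hom (b := inl : vert X -> vert sd_gog)) => [{}v g|e].
  by rewrite sd_path_vin; apply: conn0.
rewrite sd_path_tin; apply: connM (conn_tin (sd_out e)).
apply: connM (connV (conn_tin (sd_out (erev e)))) _.
by case: e => o b; apply: (conn_tin (sd_mid (o, b))).
Qed.

(** The left inverse of [sd_path] contracts each outer edge to its end in X, on
which the group of the new vertex becomes a subgroup. *)
Definition sd_retr_vert (v : vert sd_gog) : {gmorph vgrp v -> path_group X} :=
  match v with
  | inl v => vin v
  | inr e => (vin (tau e) \o cent_in (delta D e) : {gmorph _ -> _})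
  end.
Definition sd_retr_edge (e : edge sd_gog) : path_group X :=
  match e with (inl o, b) => tin (o, b) | (inr e, _) => 1 end.

Lemma sd_retr_edgeV e : sd_retr_edge (erev e) = (sd_retr_edge e)^-1.
Proof. by case: e => [[o|e] b] /=; rewrite ?invg1 // -tin_rev. Qed.

Lemma sd_retr_edgeE e (g : egrp e.1) :
  sd_retr_vert _ (emap (erev e) g)
    = ad (sd_retr_edge e) (sd_retr_vert _ (emap e g)).
Proof.
case: e g => [[o b|e []]] g; first exact: (vin_edge (e := (o, b)) g).
all: by rewrite /ad /= mul1g invg1 mulg1.
Qed.

Definition sd_retr : {gmorph path_group sd_gog -> path_group X} :=
  path_lift sd_retr_edgeV sd_retr_edgeE.

Lemma sd_retr_vin v g : sd_retr (vin v g) = sd_retr_vert v g.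
Proof. exact: path_lift_vin. Qed.
Lemma sd_retr_tin e : sd_retr (tin e) = sd_retr_edge e.
Proof. exact: path_lift_tin. Qed.

Definition sd_coll (v : vert sd_gog) : vert X :=
  match v with inl v => v | inr e => tau e end.
(** The path along which the vertex v is moved by the contraction, from its
image to v. *)
Definition sd_arm (v : vert sd_gog) : path_group sd_gog :=
  match v with inl v => 1 | inr e => (tin (sd_out e))^-1 end.

Lemma sd_path_bij v : bijective (pi1_res (@sd_path_conn v v)).
Proof.
apply: (@pi1_res_bij _ _ _ _ sd_path_conn sd_retr sd_coll sd_arm) => //.
- apply: conn_hom => [{}v g|e].
    by rewrite sd_retr_vin; case: v g => [v|e] g; apply: conn0.
  rewrite sd_retr_tin; case: e => [[o b|e []]]; rewrite /iota /=.
  + by have := conn_tin (o, b).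
  + exact: conn1.
  + exact: conn1.
- apply: (path_hom_ext (f := (sd_retr \o sd_path : {gmorph _ -> _}))
      (h := (idfun : {gmorph _ -> _}))) => [{}v g|[o b]].
    rewrite -[LHS]/(sd_retr (sd_path (vin v g))).
    by rewrite sd_path_vin sd_retr_vin.
  rewrite -[LHS]/(sd_retr (sd_path (tin (o, b)))).
  rewrite sd_path_tin !gmulfM gmulfV !sd_retr_tin /=.
  by rewrite invg1 mul1g mulg1.
- move=> {}v w x.
  apply: (conn_natural (f := (sd_path \o sd_retr : {gmorph _ -> _}))
      (h := (idfun : {gmorph _ -> _}))) => [{w x}v g|{w x}e].
    rewrite -[LHS]/(sd_path (sd_retr (vin v g))).
    rewrite sd_retr_vin; case: v g => [v|e] g.
      rewrite -[sd_retr_vert _ _]/(vin v g) sd_path_vin.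
      by rewrite /ad mul1g invg1 mulg1.
    rewrite -[sd_retr_vert _ _]/(vin (tau e) (cent_in _ g)) sd_path_vin.
    rewrite -[h in ad _ h]/(vin (inr e : vert sd_gog) g) sd_out_cent.
    by rewrite /ad invgK !mulgA mulVg mul1g mulgVK.
  rewrite -[LHS]/(sd_path (sd_retr (tin e))).
  rewrite sd_retr_tin; case: e => [[o b|e []]].
  + by rewrite sd_path_tin /sd_path_edge -[RHS]/(sd_arm _ * _ * _) /= invgK.
  + by rewrite gmulf1 /= invg1 mulg1 mulVg.
  + by rewrite gmulf1 /= invgK mul1g (tin_rev (sd_out e)) mulVg.
Qed.

Hypothesis D_vert : forall v g, avert D v g = g.

Lemma sd_map_out e : path_map sd_aut (tin (sd_out e))
  = tin (sd_out e) * (vin (inl (tau e) : vert sd_gog) (delta D e))^-1.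
Proof.
rewrite path_map_tin -[LHS]/(vin (inr e : vert sd_gog) 1 * _ * _).
by rewrite gmulf1 mul1g.
Qed.

Lemma sd_map_mid e : path_map sd_aut (tin (sd_mid e)) = tin (sd_mid e).
Proof.
rewrite path_map_tin; case: e => o b.
rewrite -[LHS]/(vin (inr (o, ~~ b) : vert sd_gog) 1 * _
                  * (vin (inr (o, b) : vert sd_gog) 1)^-1).
by rewrite !gmulf1 mul1g invg1 mulg1.
Qed.

Lemma sd_path_map x : sd_path (path_map D x) = path_map sd_aut (sd_path x).
Proof.
move: x; apply: (path_hom_ext (f := (sd_path \o path_map D : {gmorph _ -> _}))
      (h := (path_map sd_aut \o sd_path : {gmorph _ -> _}))) => [v g|e].
  rewrite -[LHS]/(sd_path (path_map D (vin v g))).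
  rewrite -[RHS]/(path_map sd_aut (sd_path (vin v g))).
  by rewrite path_map_vin path_map_vertE D_vert sd_path_vin path_map_vin.
rewrite -[LHS]/(sd_path (path_map D (tin e))).
rewrite -[RHS]/(path_map sd_aut (sd_path (tin e))).
rewrite path_map_tin !gmulfM gmulfV !sd_path_vin !sd_path_tin !gmulfM gmulfV.
by rewrite !sd_map_out sd_map_mid /sd_path_edge !invgM !invgK !mulgA.
Qed.

Lemma sd_dehn_twist_automorphism v : dehn_twist_automorphism (pi1_map D v).
Proof.
exists sd_gog, sd_aut, (inl v), (pi1_res (@sd_path_conn v v)); split.
- exact: sd_classical.
- exact: sd_path_bij.
- by move=> x; apply: pi1_in_inj; apply: sd_path_map.
Qed.

End Subdivision.

(** The definition of a Dehn twist automorphism allows a change of the graph of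
groups; the subdivision is where a general Dehn twist becomes classical. *)
Lemma dehn_twist_pi1_map (X : gog) (D : gog_aut X) (v : vert X) :
  dehn_twist D -> dehn_twist_automorphism (pi1_map D v).
Proof. by case=> D_vert _ D_cent; apply: sd_dehn_twist_automorphism. Qed.

(** * Properties of a blow-up *)

Section BlowUpTheory.
Variables (Xb : gog) (Db : gog_aut Xb) (V0 : {set vert Xb}).
Variables (Xi : {V : vert Xb | V \in V0} -> gog).
Variables (Di : forall i, gog_aut (Xi i)).
Variables (p : forall i, vert (Xi i)).
Variable theta : forall i, {gmorph vgrp (sval i) -> pi1 (p i)}.
Variables (X : gog) (D : gog_aut X) (B : blow_up Db Di theta D).

Local Notation inV0 h := (exist (fun V => is_true (V \in V0)) _ h).
Local Notation outV0 h := (exist (fun V => is_true (V \notin V0)) _ h).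

Definition bu_vert_sum (s : {V | V \notin V0} + {i & vert (Xi i)}) : vert X :=
  match s with
  | inl V => bu_vert B V
  | inr u => sub_vert (bu_sub B (tag u)) (tagged u)
  end.

Definition bu_edge_sum (s : edge Xb + {i & edge (Xi i)}) : edge X :=
  match s with
  | inl e => edge_map (bu_geo B) e
  | inr u => edge_map (sub_geo (bu_sub B (tag u))) (tagged u)
  end.

Lemma bu_vert_sum_inj : injective bu_vert_sum.
Proof.
have dis V i w : bu_vert B V <> sub_vert (bu_sub B i) w.
  move=> E.
  have [/(_ (ex_intro _ V E)) h _] := bu_vert_im B (sub_vert (bu_sub B i) w).
  by apply: h; exists i, w.
case=> [V|[i v]] [W|[j w]] /= E.
- by rewrite (bu_vert_inj E).
- by case: (dis _ _ _ E).
- by case: (dis _ _ _ (esym E)).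
- have ij := bu_disjoint E; case: _ / ij w E => w /sub_vert_inj -> //.
Qed.

Lemma bu_vert_sum_surj v : exists s, bu_vert_sum s = v.
Proof.
have [[i [w <-]]|/bu_vert_im[V <-]] :=
  pselect (exists i w, sub_vert (bu_sub B i) w = v).
  by exists (inr (Tagged (fun i => vert (Xi i)) w)).
by exists (inl V).
Qed.

Lemma bu_edge_sum_inj : injective bu_edge_sum.
Proof.
have dis O i o : bu_geo B O <> sub_geo (bu_sub B i) o.
  move=> E.
  have [/(_ (ex_intro _ O E)) h _] := bu_geo_im B (sub_geo (bu_sub B i) o).
  by apply: h; exists i, o.
case=> [[O b]|[i [o b]]] [[O' b']|[j [o' b']]] /= [E ->].
- by rewrite (bu_geo_inj E).
- by case: (dis _ _ _ E).
- by case: (dis _ _ _ (esym E)).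
- have ij : i = j.
    have := congr1 (fun o => tau (o, true)) E.
    rewrite -[LHS]/(tau (edge_map (sub_geo (bu_sub B i)) (o, true))).
    rewrite -[RHS]/(tau (edge_map (sub_geo (bu_sub B j)) (o', true))).
    by rewrite !sub_tau; apply: bu_disjoint.
  by case: _ / ij o' E => o' /sub_geo_inj ->.
Qed.

Lemma bu_edge_sum_surj e : exists s, bu_edge_sum s = e.
Proof.
case: e => o b.
have [[i [o' <-]]|/bu_geo_im[O <-]] :=
  pselect (exists i o', sub_geo (bu_sub B i) o' = o).
  by exists (inr (Tagged (fun i => edge (Xi i)) (o', b))).
by exists (inl (O, b)).
Qed.

Lemma Theta_path_in i g :
  Theta_path B (vin (sval i) g) = sub_path (bu_sub B i) (pi1_in _ (theta i g)).
Proof.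
case: i g => V h g; rewrite Theta_path_vin /Theta_vert.
by rewrite (mem_decT h) Theta_inE.
Qed.

Lemma Theta_path_out V g :
  Theta_path B (vin (sval V) g) = vin (bu_vert B V) (bu_vgrp B V g).
Proof.
case: V g => V h g; rewrite Theta_path_vin /Theta_vert.
by rewrite (mem_decF h) Theta_outE.
Qed.

Lemma bu_base_in i : bu_base B (sval i) = sub_vert (bu_sub B i) (p i).
Proof. by case: i => V h; rewrite /bu_base (mem_decT h). Qed.

Lemma bu_base_out V : bu_base B (sval V) = bu_vert B V.
Proof. by case: V => V h; rewrite /bu_base (mem_decF h). Qed.

Lemma Theta_gamma_in e (h : tau e \in V0) :
  Theta_gamma B e = sub_path (bu_sub B _) (bu_gamma B h).
Proof. by rewrite /Theta_gamma (mem_decT h). Qed.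

Lemma Theta_gamma_out e (h : tau e \notin V0) : Theta_gamma B e = 1.
Proof. by rewrite /Theta_gamma (mem_decF h). Qed.

Lemma blow_up_locally_zero e (h : tau e \in V0) : locally_zero Db Di theta h.
Proof.
exists (bu_att B h), (bu_gamma B h); split; first exact: bu_gamma_conn.
have [x xE] :=
    sub_vgrp_lift (delta D (edge_map (bu_geo B) e)) (bu_tau_in B h).
exists x; rewrite (bu_delta_in xE) gmulfV !mulgA mulVg mul1g mulgVK //.
Qed.

Section Twist.
Hypotheses (HDb : partial_dehn_twist V0 Db) (HDi : forall i, dehn_twist (Di i)).

Lemma commute_ve (Y : gog) (v w : vert Y) (g h : vgrp v) (g' h' : vgrp w) :
  ve g = ve g' -> ve h = ve h' -> v = w -> commute g' h' -> commute g h.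
Proof.
move=> gE hE vw; case: _ / vw g' h' gE hE => g' h' /ve_inj -> /ve_inj -> //.
Qed.

(** The three conditions are inherited from the pieces of X; only the edges
ending at a vertex of V0 are in no piece together with their end, and they have
trivial edge groups. *)
Lemma blow_up_dehn_twist : dehn_twist D.
Proof.
have [E0 HDe HDv HDc] := HDb; split.
- move=> v; have [s <-] := bu_vert_sum_surj v; case: s => [V|[i w]] g /=.
    by rewrite -[g](gmorphVK (bu_vgrp_bij B V)) -bu_avert HDv // (valP V).
  have [Rv _ _] := bu_restr B i; have [Iv _ _] := HDi i.
  by rewrite -[g](gmorphVK (sub_vgrp_bij (bu_sub B i) w)) Rv Iv.
- move=> o; have [s so] := bu_edge_sum_surj (o, true).
  case: s so => [[O b]|[i [o' b]]] [<- _] g.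
    by rewrite -[g](gmorphVK (bu_egrp_bij B O)) -bu_aedge HDe.
  have [_ Re _] := bu_restr B i; have [_ Ie _] := HDi i.
  by rewrite -[g](gmorphVK (sub_egrp_bij (bu_sub B i) o')) Re Ie.
- move=> e; have [s <-] := bu_edge_sum_surj e.
  case: s => [E|[i e']] g.
    rewrite -[g](gmorphVK (bu_egrp_bij B E.1)).
    move: (gmorph_inverse _ _) => {}g.
    have [h|h] := boolP (tau E \in V0).
      by rewrite (E0 E h g) !gmulf1; apply: commute1.
    apply: commute_ve (bu_delta_out B h) (bu_emap_out B h g) (bu_tau_out B h) _.
    exact/gmulf_commute/HDc.
  rewrite -[g](gmorphVK (sub_egrp_bij (bu_sub B i) e'.1)).
  move: (gmorph_inverse _ _) => {}g.
  have [_ _ Rd] := bu_restr B i; have [_ _ Ic] := HDi i.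
  apply: commute_ve (Rd e') (sub_emap (bu_sub B i) g) _ _.
    exact: (sub_tau (bu_sub B i) e').
  exact/gmulf_commute/Ic.
Qed.
End Twist.

Lemma sub_path_map i x :
  path_map D (sub_path (bu_sub B i) x)
    = sub_path (bu_sub B i) (path_map (Di i) x).
Proof.
have [Rv _ Rd] := bu_restr B i; set S := bu_sub B i in Rv Rd *.
move: x; apply: (path_hom_ext
    (f := (path_map D \o sub_path S : {gmorph _ -> _}))
    (h := (sub_path S \o path_map (Di i) : {gmorph _ -> _}))) => [v g|e].
  rewrite -[LHS]/(path_map D (sub_path S (vin v g))).
  rewrite -[RHS]/(sub_path S (path_map (Di i) (vin v g))).
  rewrite sub_path_vin sub_path_vertE !path_map_vin !path_map_vertE.
  by rewrite sub_path_vin sub_path_vertE Rv.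
rewrite -[LHS]/(path_map D (sub_path S (tin e))).
rewrite -[RHS]/(sub_path S (path_map (Di i) (tin e))).
rewrite sub_path_tin !path_map_tin /path_map_edge !gmulfM gmulfV.
rewrite !sub_path_vin sub_path_tin !sub_path_vertE.
by rewrite -(vin_ve (Rd e)) -(vin_ve (Rd (erev e))).
Qed.

Section Conjugacy.
Hypothesis theta_Di : forall i x,
  theta i (avert Db (sval i) x) = pi1_map (Di i) (p i) (theta i x).

(** With the trivial connecting path at an end outside V0, the two conditions
that a blow-up puts on correction terms become a single formula. *)
Lemma Theta_path_delta e :
  Theta_path B (vin _ (delta Db e))
    = path_map D (Theta_gamma B e) * vin _ (delta D (edge_map (bu_geo B) e))
        * (Theta_gamma B e)^-1.
Proof.
have [h|h] := boolP (tau e \in V0).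
  have [x xE] :=
    sub_vgrp_lift (delta D (edge_map (bu_geo B) e)) (bu_tau_in B h).
  rewrite (Theta_path_in (i := inV0 h)) (bu_delta_in xE).
  rewrite !(Theta_gamma_in h) sub_path_map !gmulfM gmulfV.
  by rewrite sub_path_vin sub_path_vertE (vin_ve xE).
rewrite (Theta_path_out (V := outV0 h)) !(Theta_gamma_out h).
by rewrite gmulf1 invg1 mul1g mulg1 (vin_ve (bu_delta_out B h)).
Qed.

(** Both composites send t_E to the image of t_e with the corrections twisted by
the connecting paths; the formula for delta(E) makes the paths cancel.  Hence
Theta intertwines the two automorphisms exactly, and not only up to an inner
automorphism. *)
Lemma Theta_path_map x :
  Theta_path B (path_map Db x) = path_map D (Theta_path B x).
Proof.
move: x; apply: (path_hom_ext
    (f := (Theta_path B \o path_map Db : {gmorph _ -> _}))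
    (h := (path_map D \o Theta_path B : {gmorph _ -> _}))) => [V g|e].
  rewrite -[LHS]/(Theta_path B (path_map Db (vin V g))).
  rewrite -[RHS]/(path_map D (Theta_path B (vin V g))).
  rewrite path_map_vin path_map_vertE.
  have [h|h] := boolP (V \in V0).
    rewrite !(Theta_path_in (i := inV0 h)).
    by rewrite sub_path_map (theta_Di (i := inV0 h)).
  rewrite !(Theta_path_out (V := outV0 h)) path_map_vin path_map_vertE.
  by rewrite (bu_avert B (V := outV0 h)).
rewrite -[LHS]/(Theta_path B (path_map Db (tin e))).
rewrite -[RHS]/(path_map D (Theta_path B (tin e))).
rewrite path_map_tin !gmulfM gmulfV !Theta_path_delta !Theta_path_tin.

rewrite /Theta_edge !gmulfM gmulfV path_map_tin /path_map_edge.
by rewrite !invgM invgK !mulgA !mulgVK.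
Qed.
End Conjugacy.

Section Bijectivity.
Hypothesis theta_bij : forall i, bijective (theta i).

Definition arm i : vert (Xi i) -> path_group (Xi i) :=
  s2val (cid2 (based_paths (p i))).
Lemma arm1 i : arm (p i) = 1.
Proof. exact: s2valP (cid2 (based_paths (p i))). Qed.
Lemma arm_conn i v : conn (p i) v (arm v).
Proof. exact: s2valP' (cid2 (based_paths (p i))) v. Qed.

(** Every element of the path group of G_i is turned into a loop at p_i along
the arms, and then into an element of the group of V_i through theta_i. *)
Definition local_retr i : {gmorph path_group (Xi i) -> path_group Xb} :=
  (vin (sval i) \o (gmorph_inverse (theta_bij i) \o retraction (@arm_conn i))
   : {gmorph _ -> _}).

Lemma local_retrE i x :
  local_retr i x
    = vin (sval i) (gmorph_inverse (theta_bij i) (retraction (@arm_conn i) x)).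
Proof. by []. Qed.

Lemma local_retr_conn i x : conn (sval i) (sval i) (local_retr i x).
Proof. by rewrite local_retrE; apply: conn0. Qed.

Lemma local_retr_theta i g :
  local_retr i (pi1_in _ (theta i g)) = vin (sval i) g.
Proof.
rewrite local_retrE; congr (vin _ _); rewrite -[RHS](gmorphK (theta_bij i)).
congr (gmorph_inverse _ _); apply: pi1_in_inj.
rewrite (retractionE (@arm_conn i) (pi1_in_conn _)).
by rewrite arm1 mul1g invg1 mulg1.
Qed.

Lemma Theta_local_retr i v w x : conn v w x ->
  Theta_path B (local_retr i x)
    = sub_path (bu_sub B i) (arm v) * sub_path (bu_sub B i) x
        * (sub_path (bu_sub B i) (arm w))^-1.
Proof.
move=> Hx; rewrite local_retrE Theta_path_in gmorphVK (retractionE _ Hx).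
by rewrite !gmulfM gmulfV.
Qed.

Lemma bu_retr_vert_exists :
  exists f : forall v : vert X, {gmorph vgrp v -> path_group Xb},
    (forall V g, f _ (bu_vgrp B V g) = vin (sval V) g)
    /\ forall i w (g : vgrp w),
         f _ (sub_vgrp (bu_sub B i) w g) = local_retr i (vin w g).
Proof.
pose F s : {gmorph vgrp (bu_vert_sum s) -> path_group Xb} :=
  match s with
  | inl V =>
      (vin (sval V) \o gmorph_inverse (bu_vgrp_bij B V) : {gmorph _ -> _})
  | inr u => (local_retr (tag u) \o (vin (tagged u)
      \o gmorph_inverse (sub_vgrp_bij (bu_sub B (tag u)) (tagged u)))
      : {gmorph _ -> _})
  end.
have [f fF] := transport (P := fun v => {gmorph vgrp v -> path_group Xb}) F
  bu_vert_sum_inj bu_vert_sum_surj.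
exists f; split=> [V g|i w g].
  rewrite (fF (inl V)) -[LHS]/(vin (sval V) (gmorph_inverse _ _)).
  by rewrite gmorphK.
rewrite (fF (inr (Tagged (fun i => vert (Xi i)) w))).
by rewrite -[LHS]/(local_retr i (vin w (gmorph_inverse _ _))) gmorphK.
Qed.

Definition bu_retr_vert := sval (cid bu_retr_vert_exists).

Lemma bu_retr_vert_out V g : bu_retr_vert _ (bu_vgrp B V g) = vin (sval V) g.
Proof. by case: (svalP (cid bu_retr_vert_exists)). Qed.

Lemma bu_retr_vert_in i w (g : vgrp w) :
  bu_retr_vert _ (sub_vgrp (bu_sub B i) w g) = local_retr i (vin w g).
Proof. by case: (svalP (cid bu_retr_vert_exists)). Qed.

Lemma bu_retr_vert_ve v w (g : vgrp v) (h : vgrp w) :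
  ve g = ve h -> bu_retr_vert _ g = bu_retr_vert _ h.
Proof.
exact: (congr1 (fun u : velt X => bu_retr_vert _ (tagged u))).
Qed.

(** The image of the connecting path of e under the retraction to be built; it
enters the value at t_e so that the retraction undoes Theta. *)
Definition bu_retr_gamma (e : edge Xb) : path_group Xb :=
  match mem_dec V0 (tau e) with
  | left h => local_retr _ (bu_gamma B h)
  | right _ => 1
  end.

Lemma bu_retr_edge_exists :
  exists f : edge X -> path_group Xb,
    (forall e, f (edge_map (bu_geo B) e)
       = (bu_retr_gamma (erev e))^-1 * tin e * bu_retr_gamma e)
    /\ forall i e,
         f (edge_map (sub_geo (bu_sub B i)) e) = local_retr i (tin e).
Proof.
pose F (s : edge Xb + {i & edge (Xi i)}) : path_group Xb :=
  match s with
  | inl e => (bu_retr_gamma (erev e))^-1 * tin e * bu_retr_gamma e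
  | inr u => local_retr (tag u) (tin (tagged u))
  end.
have [f fF] := transport (P := fun=> path_group Xb : Type) F
  bu_edge_sum_inj bu_edge_sum_surj.
exists f; split=> [e|i e]; first exact: (fF (inl e)).
exact: (fF (inr (Tagged (fun i => edge (Xi i)) e))).
Qed.

Definition bu_retr_edge := sval (cid bu_retr_edge_exists).

Lemma bu_retr_edge_out e : bu_retr_edge (edge_map (bu_geo B) e)
  = (bu_retr_gamma (erev e))^-1 * tin e * bu_retr_gamma e.
Proof. by case: (svalP (cid bu_retr_edge_exists)). Qed.

Lemma bu_retr_edge_in i e :
  bu_retr_edge (edge_map (sub_geo (bu_sub B i)) e) = local_retr i (tin e).
Proof. by case: (svalP (cid bu_retr_edge_exists)). Qed.

(** Thanks to this formula the relation of t_e in X follows from its relation in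
the collapsed graph of groups. *)
Lemma bu_retr_emap_out e (g : egrp e.1) :
  bu_retr_vert _ (emap (edge_map (bu_geo B) e) (bu_egrp B e.1 g))
    = ad (bu_retr_gamma e)^-1 (vin _ (emap e g)).
Proof.
rewrite /bu_retr_gamma; case: mem_dec => h.
  have [x xE] :=
    sub_vgrp_lift (emap (edge_map (bu_geo B) e) (bu_egrp B e.1 g))
      (bu_tau_in B h).
  rewrite -(bu_retr_vert_ve xE) bu_retr_vert_in.
  rewrite -(local_retr_theta (i := inV0 h)) (bu_emap_in xE) /ad !gmulfM gmulfV.
  by rewrite invgK !mulgA mulVg mul1g mulgVK.
rewrite (bu_retr_vert_ve (bu_emap_out B h g)) bu_retr_vert_out.
by rewrite /ad !invg1 mul1g mulg1.
Qed.

Lemma bu_retr_edgeV e : bu_retr_edge (erev e) = (bu_retr_edge e)^-1.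
Proof.
have [s <-] := bu_edge_sum_surj e; case: s => [{}e|[i {}e]] /=.
  rewrite (bu_retr_edge_out (erev e)) bu_retr_edge_out erevK tin_rev.
  by rewrite !invgM invgK mulgA.
by rewrite (bu_retr_edge_in (erev e)) bu_retr_edge_in tin_rev gmulfV.
Qed.

Lemma bu_retr_edgeE e (g : egrp e.1) :
  bu_retr_vert _ (emap (erev e) g)
    = ad (bu_retr_edge e) (bu_retr_vert _ (emap e g)).
Proof.
have [s se] := bu_edge_sum_surj e; case: _ / se g.
case: s => [{}e|[i {}e]] /= g.
  rewrite -[g](gmorphVK (bu_egrp_bij B e.1)); move: (gmorph_inverse _ _) => {}g.
  rewrite (bu_retr_emap_out (e := erev e)) (bu_retr_emap_out (e := e)).
  rewrite bu_retr_edge_out.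
  rewrite vin_edge /ad !invgM !invgK !mulgA.
  by rewrite !mulgK.
rewrite -[g](gmorphVK (sub_egrp_bij (bu_sub B i) e.1)).
move: (gmorph_inverse _ _) => {}g.
rewrite (bu_retr_vert_ve (sub_emap (bu_sub B i) (e := e) g)).
rewrite (bu_retr_vert_ve (sub_emap (bu_sub B i) (e := erev e) g)).
by rewrite !bu_retr_vert_in bu_retr_edge_in vin_edge /ad !gmulfM gmulfV.
Qed.

(** The left inverse of Theta on path groups. *)
Definition bu_retr : {gmorph path_group X -> path_group Xb} :=
  path_lift bu_retr_edgeV bu_retr_edgeE.

Lemma bu_retr_vin v g : bu_retr (vin v g) = bu_retr_vert _ g.
Proof. exact: path_lift_vin. Qed.
Lemma bu_retr_tin e : bu_retr (tin e) = bu_retr_edge e.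
Proof. exact: path_lift_tin. Qed.

Lemma bu_retr_sub_path i x : bu_retr (sub_path (bu_sub B i) x) = local_retr i x.
Proof.
move: x; apply: (path_hom_ext
    (f := (bu_retr \o sub_path (bu_sub B i) : {gmorph _ -> _}))
    (h := local_retr i)) => [v g|e].
  rewrite -[LHS]/(bu_retr (sub_path (bu_sub B i) (vin v g))).
  by rewrite sub_path_vin sub_path_vertE bu_retr_vin bu_retr_vert_in.
rewrite -[LHS]/(bu_retr (sub_path (bu_sub B i) (tin e))).
by rewrite sub_path_tin bu_retr_tin bu_retr_edge_in.
Qed.

Lemma bu_retr_Theta_gamma e : bu_retr (Theta_gamma B e) = bu_retr_gamma e.
Proof.
rewrite /Theta_gamma /bu_retr_gamma; case: mem_dec => h; last exact: gmulf1.
exact: bu_retr_sub_path.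
Qed.

Lemma Theta_pathK : cancel (Theta_path B) bu_retr.
Proof.
apply: (path_hom_ext (f := (bu_retr \o Theta_path B : {gmorph _ -> _}))
    (h := (idfun : {gmorph _ -> _}))) => [V g|e].
  rewrite -[LHS]/(bu_retr (Theta_path B (vin V g))) -[RHS]/(vin V g).
  have [h|h] := boolP (V \in V0).
    rewrite (Theta_path_in (i := inV0 h)) bu_retr_sub_path.
    exact: local_retr_theta.
  rewrite (Theta_path_out (V := outV0 h)) bu_retr_vin.
  exact: (bu_retr_vert_out (V := outV0 h)).
rewrite -[LHS]/(bu_retr (Theta_path B (tin e))) -[RHS]/(tin e).
rewrite Theta_path_tin !gmulfM gmulfV !bu_retr_Theta_gamma bu_retr_tin.
rewrite bu_retr_edge_out.
by rewrite !mulgA mulgV mul1g mulgK.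
Qed.

(** The collapse of the vertices of X, together with the paths along which the
vertices of each G_i are moved to p_i. *)
Lemma bu_arms_exist :
  exists f : vert X -> vert Xb * path_group X,
    (forall V, f (bu_vert B V) = (sval V, 1))
    /\ forall i w,
         f (sub_vert (bu_sub B i) w) = (sval i, sub_path (bu_sub B i) (arm w)).
Proof.
pose F (s : {V | V \notin V0} + {i & vert (Xi i)}) : vert Xb * path_group X :=
  match s with
  | inl V => (sval V, 1)
  | inr u => (sval (tag u), sub_path (bu_sub B (tag u)) (arm (tagged u)))
  end.
have [f fF] := transport (P := fun=> (vert Xb * path_group X)%type : Type) F
  bu_vert_sum_inj bu_vert_sum_surj.
exists f; split=> [V|i w]; first exact: (fF (inl V)).
exact: (fF (inr (Tagged (fun i => vert (Xi i)) w))).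
Qed.

Lemma Theta_bij V : bijective (Theta B V).
Proof.
have [f [f_out f_in]] := bu_arms_exist.
have f_base W : f (bu_base B W) = (W, 1).
  have [h|h] := boolP (W \in V0).
    by rewrite (bu_base_in (inV0 h)) f_in arm1 gmulf1.
  by rewrite (bu_base_out (outV0 h)) f_out.
have f_gamma e : (f (tau (edge_map (bu_geo B) e))).1 = tau e
    /\ Theta_path B (bu_retr_gamma e)
       = Theta_gamma B e * ((f (tau (edge_map (bu_geo B) e))).2)^-1.
  rewrite /bu_retr_gamma /Theta_gamma; case: mem_dec => h.
    rewrite (bu_tau_in B h) f_in; split=> //.
    rewrite (Theta_local_retr (bu_gamma_conn B h)) arm1 gmulf1 mul1g //.
  by rewrite (bu_tau_out B h) f_out gmulf1 invg1 mulg1.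
apply: (@pi1_res_bij _ _ _ _ (@Theta_path_conn _ _ _ _ _ _ _ _ _ B) bu_retr
          (fst \o f) (snd \o f)).
- apply: conn_hom => [v g|e].
    rewrite bu_retr_vin /=; have [s sv] := bu_vert_sum_surj v; case: _ / sv g.
    case: s => [{}V|[i w]] g /=.
      rewrite f_out -[g](gmorphVK (bu_vgrp_bij B V)) bu_retr_vert_out.
      exact: conn0.
    rewrite f_in -[g](gmorphVK (sub_vgrp_bij (bu_sub B i) w)) bu_retr_vert_in.
    exact: local_retr_conn.
  rewrite bu_retr_tin /=; have [s <-] := bu_edge_sum_surj e.
  case: s => [{}e|[i {}e]] /=.
    rewrite bu_retr_edge_out (f_gamma (erev e)).1 (f_gamma e).1.
    have rg e' : conn (tau e') (tau e') (bu_retr_gamma e').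
      rewrite /bu_retr_gamma; case: mem_dec => h; last exact: conn1.
      exact: (local_retr_conn (i := inV0 h)).
    exact: connM (connM (connV (rg (erev e))) (conn_tin e)) (rg e).
  rewrite bu_retr_edge_in /iota (sub_tau (bu_sub B i) (erev e)).
  by rewrite (sub_tau (bu_sub B i) e) !f_in; apply: local_retr_conn.
- exact: Theta_pathK.
- by move=> W; rewrite /= f_base.
- by move=> W; rewrite /= f_base.
- apply: (conn_natural (f := (Theta_path B \o bu_retr : {gmorph _ -> _}))
      (h := (idfun : {gmorph _ -> _}))) => [v g|e].
    rewrite -[LHS]/(Theta_path B (bu_retr (vin v g))).
    rewrite bu_retr_vin; have [s sv] := bu_vert_sum_surj v; case: _ / sv g.
    case: s => [{}V|[i w]] g.
      rewrite -[LHS]/(Theta_path B (bu_retr_vert (bu_vert B V) g)).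
      rewrite -[RHS]/(ad (f (bu_vert B V)).2 (vin (bu_vert B V) g)).
      rewrite f_out -[g](gmorphVK (bu_vgrp_bij B V)) bu_retr_vert_out.
      by rewrite Theta_path_out /ad /= mul1g invg1 mulg1.
    rewrite -[LHS]/(Theta_path B (bu_retr_vert (sub_vert (bu_sub B i) w) g)).
    rewrite -[RHS]/(ad (f (sub_vert (bu_sub B i) w)).2 (vin _ g)).
    rewrite f_in -[g](gmorphVK (sub_vgrp_bij (bu_sub B i) w)) bu_retr_vert_in.
    by rewrite (Theta_local_retr (conn0 _)) sub_path_vin.
  rewrite -[LHS]/(Theta_path B (bu_retr (tin e))).
  rewrite bu_retr_tin; have [s <-] := bu_edge_sum_surj e.
  case: s => [{}e|[i {}e]].
    rewrite bu_retr_edge_out !gmulfM gmulfV.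
    rewrite (f_gamma (erev e)).2 (f_gamma e).2 Theta_path_tin /Theta_edge.
    by rewrite !invgM invgK !mulgA !mulgVK.
  rewrite bu_retr_edge_in (Theta_local_retr (conn_tin e)) sub_path_tin.
  rewrite /= /iota (sub_tau (bu_sub B i) (erev e)) (sub_tau (bu_sub B i) e).
  by rewrite !f_in.
Qed.
End Bijectivity.

End BlowUpTheory.

(** * Construction of a blow-up from local zeroness *)

Section Construction.
Variables (Xb : gog) (Db : gog_aut Xb) (V0 : {set vert Xb}).
Hypothesis HDb : partial_dehn_twist V0 Db.
Variables (Xi : {V : vert Xb | V \in V0} -> gog).
Variables (Di : forall i, gog_aut (Xi i)).
Variables (p : forall i, vert (Xi i)).
Variable theta : forall i, {gmorph vgrp (sval i) -> pi1 (p i)}.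
Hypothesis lz : forall (e : edge Xb) (h : tau e \in V0),
  locally_zero Db Di theta h.

Local Notation inV0 h := (exist (fun V => is_true (V \in V0)) _ h).
Local Notation outV0 h := (exist (fun V => is_true (V \notin V0)) _ h).

Section LocalChoice.
Variables (e : edge Xb) (h : tau e \in V0).

Definition att : vert (Xi (inV0 h)) := sval (cid (lz h)).
Definition att_path : path_group (Xi (inV0 h)) :=
  sval (cid (svalP (cid (lz h)))).

Lemma att_path_conn : conn (p _) att att_path.
Proof. by case: (svalP (cid (svalP (cid (lz h))))). Qed.

Lemma att_elt_exists : exists x : vgrp att,
  path_map (Di _) (att_path^-1) * pi1_in _ (theta (inV0 h) (delta Db e))
      * att_path = vin att x.
Proof. by case: (svalP (cid (svalP (cid (lz h))))). Qed.

Definition att_elt : vgrp att := sval (cid att_elt_exists).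

Lemma att_eltE : pi1_in _ (theta (inV0 h) (delta Db e))
  = path_map (Di _) att_path * vin att att_elt * att_path^-1.
Proof.
rewrite -(svalP (cid att_elt_exists)) gmulfV !mulgA mulgV mul1g mulgK //.
Qed.
End LocalChoice.

Definition blown_vert : finType := ({V | V \notin V0} + {i & vert (Xi i)})%type.
Definition blown_geo : finType := (geo Xb + {i & geo (Xi i)})%type.

Definition blown_vgrp (v : blown_vert) : groupType :=
  match v with inl V => vgrp (sval V) | inr u => vgrp (tagged u) end.
Definition blown_egrp (o : blown_geo) : groupType :=
  match o with inl o => egrp o | inr u => egrp (tagged u) end.

(** The end of an edge: its terminal vertex, its edge homomorphism and its
correction term.  The last two have types that depend on the first, so that the
three are defined together; for an edge of the collapsed graph they depend on a
decision whether its end is in V0. *)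
Definition germ (G : groupType) :=
  {v : blown_vert & ({gmorph G -> blown_vgrp v} * blown_vgrp v)%type}.

Definition inr_vert i (w : vert (Xi i)) : blown_vert :=
  inr (Tagged (fun i => vert (Xi i)) w).

Definition inr_geo i (o : geo (Xi i)) : blown_geo :=
  inr (Tagged (fun i => geo (Xi i)) o).

Definition mk_germ (G : groupType) v (f : {gmorph G -> blown_vgrp v})
    (d : blown_vgrp v) : germ G := existT _ v (f, d).

Definition gtriv (G H : groupType) : {gmorph G -> H} :=
  @mk_gmorph G H (fun=> 1) (fun x y => esym (mul1g 1)).

Definition germ_in (e : edge Xb) (h : tau e \in V0) : germ (egrp e.1) :=
  @mk_germ _ (inr_vert (att h)) (gtriv _ _) (att_elt h).
Definition germ_out (e : edge Xb) (h : tau e \notin V0) : germ (egrp e.1) :=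
  @mk_germ _ (inl (outV0 h)) (emap e) (delta Db e).
Definition germ_old (e : edge Xb) : germ (egrp e.1) :=
  match mem_dec V0 (tau e) with left h => germ_in h | right h => germ_out h end.
Definition germ_local i (e : edge (Xi i)) : germ (egrp e.1) :=
  @mk_germ _ (inr_vert (tau e)) (emap e) (delta (Di i) e).

Definition germ_of (e : blown_geo * bool) : germ (blown_egrp e.1) :=
  match e with
  | (inl o, b) => germ_old (o, b)
  | (inr u, b) => germ_local (tagged u, b)
  end.

Lemma germ_oldT e (h : tau e \in V0) : germ_old e = germ_in h.
Proof. by rewrite /germ_old (mem_decT h). Qed.
Lemma germ_oldF e (h : tau e \notin V0) : germ_old e = germ_out h.
Proof. by rewrite /germ_old (mem_decF h). Qed.

Definition blown_pregraph : pregraph :=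
  @PreGraph blown_vert blown_geo (fun e => tag (germ_of e)).

Definition old_edge (e : edge Xb) : edge blown_pregraph := (inl e.1, e.2).
Definition local_edge i (e : edge (Xi i)) : edge blown_pregraph :=
  (inr_geo e.1, e.2).

Lemma tau_local i (e : edge (Xi i)) : tau (local_edge e) = inr_vert (tau e).
Proof. by case: e. Qed.
Lemma tau_in (e : edge Xb) (h : tau e \in V0) :
  tau (old_edge e) = inr_vert (att h).
Proof. by case: e h => o b h; exact: (congr1 tag (germ_oldT h)). Qed.
Lemma tau_out (e : edge Xb) (h : tau e \notin V0) :
  tau (old_edge e) = inl (outV0 h).
Proof. by case: e h => o b h; exact: (congr1 tag (germ_oldF h)). Qed.

(** A section of the collapse of vertices.  An edge path of the collapsed graph
lifts to a path between such vertices once the gaps inside each G_i are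
filled. *)
Definition blown_base (V : vert Xb) : blown_vert :=
  match mem_dec V0 V with
  | left h => inr_vert (p (inV0 h))
  | right h => inl (outV0 h)
  end.

Lemma blown_reach_local i (v w : vert (Xi i)) :
  @reach blown_pregraph (inr_vert v) (inr_vert w).
Proof.
apply: (reach_hom (f := @inr_vert i : vert (Xi i) -> vert blown_pregraph))
  (graph_connected v w) => e.
rewrite -(tau_local e) /iota -(tau_local (erev e)).
exact: (@reach_edge blown_pregraph (local_edge e)).
Qed.

Lemma blown_reach_tau (e : edge Xb) :
  @reach blown_pregraph (blown_base (tau e)) (tau (old_edge e)).
Proof.
rewrite /blown_base; case: mem_dec => h.
  by rewrite (tau_in h); apply: blown_reach_local.
by rewrite (tau_out h); apply: reach_refl.
Qed.

Lemma blown_reach (v w : vert blown_pregraph) : reach v w.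
Proof.
have to u : exists W, @reach blown_pregraph u (blown_base W).
  case: u => [[V h]|[[V h] u]].
    by exists V; rewrite /blown_base (mem_decF h); apply: reach_refl.
  by exists V; rewrite /blown_base (mem_decT h); apply: blown_reach_local.
have [[V vV] [W wW]] := (to v, to w).
apply: reach_trans vV (reach_trans _ (reach_sym wW)).
apply: (reach_hom (f := blown_base : vert Xb -> vert blown_pregraph))
  (graph_connected V W).
move=> e; apply: reach_trans (blown_reach_tau (erev e)) _.
apply: reach_trans (reach_sym (blown_reach_tau e)).
exact: (@reach_edge blown_pregraph (old_edge e)).
Qed.

Lemma blown_nonempty : exists v : vert blown_pregraph, True.
Proof. by have [V _] := graph_nonempty Xb; exists (blown_base V). Qed.

Definition blown_graph : graph := Graph blown_nonempty blown_reach.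

Definition blown_emap (e : edge blown_graph)
    : {gmorph blown_egrp e.1 -> blown_vgrp (tau e)} :=
  (tagged (germ_of e)).1.
Definition blown_delta (e : edge blown_graph) : blown_vgrp (tau e) :=
  (tagged (germ_of e)).2.

(** Axioms of a graph of groups and of an automorphism concern one end of an
edge at a time; this reduces them to the three sources of ends without unfolding
the decision on V0. *)
Lemma germ_ind
    (P : forall e : edge blown_graph, germ (blown_egrp e.1) -> Prop) :
  (forall (e : edge Xb) (h : tau e \in V0), P (inl e.1, e.2) (germ_in h)) ->
  (forall (e : edge Xb) (h : tau e \notin V0), P (inl e.1, e.2) (germ_out h)) ->
  (forall i (e : edge (Xi i)), P (local_edge e) (germ_local e)) ->
  forall e, P e (germ_of e).
Proof.
move=> Pin Pout Ploc [[o|[i o]] b] /=; last exact: (Ploc i (o, b)).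
rewrite /germ_old; case: mem_dec => h; first exact: (Pin (o, b)).
exact: (Pout (o, b)).
Qed.

Lemma blown_emap_inj e : injective (blown_emap e).
Proof.
have [E0 _ _ _] := HDb.
move: e.
apply: (germ_ind (P := fun e x => injective (tagged x).1)) => [e h|e h|i e].
- by move=> x y _; rewrite (E0 e h x) (E0 e h y).
- exact: emap_inj.
- exact: emap_inj.
Qed.

Definition blown_gog : gog := Gog blown_emap_inj.

Definition blown_avert (v : vert blown_gog) : {gmorph vgrp v -> vgrp v} :=
  match v with
  | inl V => avert Db (sval V)
  | inr u => avert (Di (tag u)) (tagged u)
  end.
Definition blown_aedge (o : geo blown_gog) : {gmorph egrp o -> egrp o} :=
  match o with
  | inl o => aedge Db o
  | inr u => aedge (Di (tag u)) (tagged u)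
  end.

Lemma blown_avert_bij v : bijective (blown_avert v).
Proof.
by case: v => [V|u]; [apply: (avert_bij Db) | apply: (avert_bij (Di _))].
Qed.
Lemma blown_aedge_bij o : bijective (blown_aedge o).
Proof.
by case: o => [o|u]; [apply: (aedge_bij Db) | apply: (aedge_bij (Di _))].
Qed.

Lemma blown_aut_emap (e : edge blown_gog) (g : egrp e.1) :
  blown_avert _ (emap e g) = ad (blown_delta e) (emap e (blown_aedge e.1 g)).
Proof.
move: e g; apply: (germ_ind (P := fun e x => forall g : blown_egrp e.1,
  blown_avert (tag x) ((tagged x).1 g)
    = ad (tagged x).2 ((tagged x).1 (blown_aedge e.1 g)))) => [e h|e h|i e] g.
- by rewrite /= gmulf1 /ad mulg1 mulgV.
- exact: aut_emap.
- exact: aut_emap.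
Qed.

Definition blown_aut : gog_aut blown_gog :=
  GogAut blown_avert_bij blown_aedge_bij blown_aut_emap.

Lemma inr_vert_inj i : injective (@inr_vert i).
Proof. by move=> v w [E]; exact: eq_from_Tagged E. Qed.

Lemma inr_geo_inj i : injective (@inr_geo i).
Proof. by move=> v w [E]; exact: eq_from_Tagged E. Qed.

Lemma blown_sub_emap i (e : edge (Xi i)) (g : egrp e.1) :
  @ve blown_gog _ (@emap blown_gog (local_edge e) g)
    = @ve blown_gog (inr_vert (tau e)) (emap e g).
Proof. by case: e g. Qed.

Definition blown_sub i : sub_gog (Xi i) blown_gog :=
  @SubGog (Xi i) blown_gog (@inr_vert i) (@inr_vert_inj i)
    (@inr_geo i) (@inr_geo_inj i) (@tau_local i)
    (fun v => idfun) (fun v => idfun_bij _) (fun o => idfun)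
    (fun o => idfun_bij _) (@blown_sub_emap i).

Lemma blown_sub_restr i : restricts_to (blown_sub i) blown_aut (Di i).
Proof. by split=> // -[o b]. Qed.

(** The values of the edge homomorphism and of the correction term depend on the
whole end; in the union of the vertex groups the end can be rewritten. *)
Definition germ_emap G (x : germ G) (g : G) : velt blown_gog :=
  @ve blown_gog (tag x) ((tagged x).1 g).
Definition germ_delta G (x : germ G) : velt blown_gog :=
  @ve blown_gog (tag x) (tagged x).2.

Lemma old_emapE e (g : egrp e.1) :
  ve (@emap blown_gog (old_edge e) g) = germ_emap (germ_old e) g.
Proof. by case: e g. Qed.

Lemma old_deltaE e :
  ve (delta blown_aut (old_edge e)) = germ_delta (germ_old e).
Proof. by case: e. Qed.

Lemma inl_iff_not_inr (T : Type) (U : T -> Type) (V : Type)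
    (s : V + {i & U i}) :
  (exists v, inl v = s) <-> ~ (exists i w, inr (existT U i w) = s).
Proof.
split=> [[v <-] [i [w]]//|]; case: s => [v _|[i w] []]; first by exists v.
by exists i, w.
Qed.

Lemma emap_inE (e : edge Xb) (h : tau e \in V0) (g : egrp e.1)
    (x : vgrp (att h)) :
  @ve blown_gog (inr_vert (att h)) x = ve (@emap blown_gog (old_edge e) g) ->
  pi1_in _ (theta (inV0 h) (emap e g)) = ad (att_path h) (vin _ x).
Proof.
have [E0 _ _ _] := HDb; rewrite (E0 e h g) => {g}.
rewrite old_emapE germ_oldT => /ve_inj xE.
have -> : x = 1 by [].
by rewrite !gmulf1 /ad mulg1 mulgV.
Qed.

(** This is where the witnesses of local zeroness are used: they were chosen to
satisfy this equation. *)
Lemma delta_inE (e : edge Xb) (h : tau e \in V0) (x : vgrp (att h)) :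
  @ve blown_gog (inr_vert (att h)) x = ve (delta blown_aut (old_edge e)) ->
  pi1_in _ (theta (inV0 h) (delta Db e))
    = path_map (Di _) (att_path h) * vin _ x * (att_path h)^-1.
Proof. by rewrite old_deltaE germ_oldT => /ve_inj ->; apply: att_eltE. Qed.

Lemma blow_up_exists : inhabited (blow_up Db Di theta blown_aut).
Proof.
constructor; apply: (@BlowUp _ _ _ _ _ _ _ _ _ blown_sub _ blown_sub_restr
  inl _ _ inl _ _ (fun V => idfun) (fun V => idfun_bij _) (fun O => idfun)
  (fun O => idfun_bij _) _ _ _ _ _ att _ att_path att_path_conn
  emap_inE delta_inE).
- by move=> i j v w [].
- by move=> V W [].
- move=> v; exact: inl_iff_not_inr.
- by move=> O O' [].
- move=> o; exact: inl_iff_not_inr.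
- by [].
- by [].
- exact: tau_out.
- by move=> e h g; rewrite old_emapE germ_oldF.
- by move=> e h; rewrite old_deltaE germ_oldF.
- exact: tau_in.
Qed.

End Construction.

(** * Dehn twist automorphisms *)

Lemma dehn_twist_automorphism_conj (G H : groupType) (f : {gmorph G -> H})
    (phi : G -> G) (psi : H -> H) :
  bijective f -> (forall x, f (phi x) = psi (f x)) ->
  dehn_twist_automorphism psi -> dehn_twist_automorphism phi.
Proof.
move=> f_bij f_conj [X [D [v [theta [D_classical theta_bij theta_conj]]]]].
exists X, D, v, (theta \o f : {gmorph _ -> _}); split=> // [|x].
  exact: bij_comp.
by rewrite /= f_conj theta_conj.
Qed.

Lemma outer_eq_refl (G H : groupType) (f : G -> H) : outer_eq f f.
Proof. by exists 1 => x; rewrite /ad mul1g invg1 mulg1. Qed.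

Theorem corollary1p2 (Xb : gog) (Db : gog_aut Xb) (V0 : {set vert Xb})
    (HDb : partial_dehn_twist V0 Db)
    (Xi : {V : vert Xb | V \in V0} -> gog)
    (Di : forall i, gog_aut (Xi i))
    (HDi : forall i, dehn_twist (Di i))
    (p : forall i, vert (Xi i))
    (theta : forall i, {gmorph vgrp (sval i) -> pi1 (p i)})
    (theta_bij : forall i, bijective (theta i))
    (theta_Di : forall i x,
       theta i (avert Db (sval i) x) = pi1_map (Di i) (p i) (theta i x)) :
  ((exists (X : gog) (D : gog_aut X), inhabited (blow_up Db Di theta D)) <->
   (forall (e : edge Xb) (h : tau e \in V0), locally_zero Db Di theta h))
  /\
  (forall (X : gog) (D : gog_aut X) (B : blow_up Db Di theta D),
     [/\ dehn_twist D,
         forall V : vert Xb,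
           [/\ bijective (Theta B V),
               outer_eq (Theta B V \o pi1_map Db V)
                        (pi1_map D (bu_base B V) \o Theta B V)
             & outer_dehn_twist_automorphism (pi1_map Db V)]
       & forall v : vert X, outer_dehn_twist_automorphism (pi1_map D v)]).
Proof.
split.
  split=> [[X [D [B]]] e h|lz]; first exact: blow_up_locally_zero B e h.
  by exists (blown_gog HDb lz), (blown_aut HDb lz); apply: blow_up_exists.
move=> X D B; have D_twist := blow_up_dehn_twist B HDb HDi.
have Dpi1 v := dehn_twist_pi1_map v D_twist.
have Theta_conj V x :
    Theta B V (pi1_map Db V x) = pi1_map D (bu_base B V) (Theta B V x).
  by apply: pi1_in_inj; apply: Theta_path_map.
split=> // [V|v].
  split; first exact: Theta_bij.
    by exists 1 => x; rewrite /ad mul1g invg1 mulg1; apply: Theta_conj.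
  exists (pi1_map Db V); last exact: outer_eq_refl.
  apply: dehn_twist_automorphism_conj (Theta_conj V) _; last exact: Dpi1.
  exact: Theta_bij.
by exists (pi1_map D v); [apply: Dpi1 | apply: outer_eq_refl].
Qed.
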